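(* For the linear Hawkes process with baseline $\mu>0$, branching ratio $\rho\in(0,1)$ and known kernel shape $g$, put $a=1-\rho$, $\bar\lambda=\mu/(1-\rho)$, $V=\lambda/\bar\lambda$, $\mathcal I_T=T\mu(1-\rho)$, $D_T=\frac1T\mathbb E\int_0^TV(t)\,\mathrm dt$, and $$B_T=\frac1T\,\mathbb E\int_0^T\frac{\mu}{\lambda(t)}\,\mathrm dt.$$ Then the Fisher information matrix of $(\log\mu,\log(1-\rho))$ on $[0,T]$ is $$\mathcal J_T=\mathcal I_T\begin{pmatrix}B_T/a&-\dfrac{1-B_T}{\rho}\\[2mm]-\dfrac{1-B_T}{\rho}&\dfrac{D_T-2a+aB_T}{\rho^2}\end{pmatrix},$$ and the efficient informations are $$\mathcal J^{\rm eff}_{\log\mu,T}=\frac{\mathcal I_T}{a}\,\frac{B_TD_T-a}{D_T-2a+aB_T},\qquad \mathcal J^{\rm eff}_{\log(1-\rho),T}=\frac{\mathcal I_T}{\rho^2}\Big(D_T-\frac{a}{B_T}\Big).$$ For a stationary record (i.e. if $N$ is the stationary Hawkes process with the same parameters) $D_T=1$.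
   Context: $N$ is the linear Hawkes process started empty at time $s_0\le0$ (no points at or before $s_0$) and observed on $[0,T]$: a simple point process with stochastic intensity $\lambda(t)=\mu+\rho\int_{(s_0,t)}g(t-s)\,N(\mathrm ds)$, where $g\ge0$ and $\int_0^\infty g=1$; the stationary Hawkes process corresponds to $s_0=-\infty$. The log-likelihood on $[0,T]$ (conditional on the pre-sample history) is $\int_{(0,T]}\log\lambda\,\mathrm dN-\int_0^T\lambda\,\mathrm dt$, as a function of $(\theta,\eta)=(\log\mu,\log(1-\rho))$. The Fisher information matrix is the covariance matrix of the gradient (score) of this log-likelihood at the true parameter, i.e. $\mathbb E\int_0^T(\nabla\lambda)(\nabla\lambda)^\top\lambda^{-1}\,\mathrm dt$. The efficient informations are the Schur complements $\mathcal J^{\rm eff}_{\log\mu,T}=\mathcal J_{\theta\theta}-\mathcal J_{\theta\eta}^2/\mathcal J_{\eta\eta}$ and $\mathcal J^{\rm eff}_{\log(1-\rho),T}=\mathcal J_{\eta\eta}-\mathcal J_{\theta\eta}^2/\mathcal J_{\theta\theta}$ (defined when the denominator is nonzero). *)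

(* Defs.v *)
From HB Require Import structures.
From mathcomp Require Import all_boot all_order all_algebra.
From mathcomp Require Import all_classical all_reals all_analysis.
From mathcomp Require Import measurable_realfun.

Set Implicit Arguments.
Unset Strict Implicit.
Unset Printing Implicit Defensive.
Import Order.TTheory GRing.Theory Num.Theory.
Import numFieldNormedType.Exports.
Local Open Scope classical_set_scope.
Local Open Scope ring_scope.

(* A simple point process on the line is encoded as a random set of points
   N : Omega -> set R, so that simplicity is built in.  Its counting measure
   is B |-> counting (N w `&` B), and the integral of f >= 0 against it is
   \esum_(s in N w) f s. *)
Definition simple_point_process {R : realType} {d : measure_display}
    {Omega : measurableType d} (N : Omega -> set R) : Prop :=
  (forall w (a b : R), finite_set (N w `&` `[a, b])) /\
  (forall B : set R, measurable B ->
     measurable_fun [set: Omega]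
       (fun w => counting (N w `&` B) : \bar R)).

(* Internal history of N up to and including time t. *)
Definition history {R : realType} {d : measure_display}
    {Omega : measurableType d} (N : Omega -> set R) (t : R)
    : set (set Omega) :=
  <<s [set A | exists B : set R, exists Y : set (\bar R),
        [/\ measurable B, B `<=` `]-oo, t], measurable Y &
            A = [set w | Y (counting (N w `&` B))]]] >>.

(* Predictable sigma-algebra of the internal history, for the time axis
   ]s0, +oo[ ; s0 = -oo is allowed. *)
Definition predictable {R : realType} {d : measure_display}
    {Omega : measurableType d} (N : Omega -> set R) (s0 : \bar R)
    : set (set (R * Omega)) :=
  <<s [set S | exists a b : R, exists A : set Omega,
        [/\ (s0 <= a%:E)%E, a < b, history N a A &
            S = `]a, b] `*` A]] >>.

Definition predictable_fun {R : realType} {d : measure_display}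
    {Omega : measurableType d} (N : Omega -> set R) (s0 : \bar R)
    (C : R * Omega -> \bar R) : Prop :=
  forall Y : set (\bar R), measurable Y -> predictable N s0 (C @^-1` Y).

(* lam is the (predictable) stochastic intensity of N on ]s0, +oo[ : it is
   nonnegative, predictable, a.s. locally integrable, and
   E int C dN = E int C lam dt for all nonnegative predictable C. *)
Definition has_stochastic_intensity {R : realType} {d : measure_display}
    {Omega : measurableType d} (P : probability Omega R)
    (N : Omega -> set R) (s0 : \bar R) (lam : R * Omega -> \bar R) : Prop :=
  [/\ forall x, (0 <= lam x)%E,
      predictable_fun N s0 lam,
      forall a b : R, (s0 <= a%:E)%E ->
        {ae P, forall w,
           (\int[@lebesgue_measure R]_(t in `[a, b]) lam (t, w) < +oo)%E} &
      forall C : R * Omega -> \bar R,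
        (forall x, (0 <= C x)%E) -> predictable_fun N s0 C ->
        ((\int[P]_w \esum_(t in N w) C (t, w)) =
         \int[P]_w \int[@lebesgue_measure R]_(t in [set t | s0 < t%:E])
           (C (t, w) * lam (t, w)))%E].

(* Conditional intensity mu + rho int_(]s0, t[) g (t - s) X(ds) attached to a
   configuration X of points.  It is extended-real valued because the sum is
   infinite when s0 = -oo. *)
Definition hawkes_intensity {R : realType} (g : R -> R) (s0 : \bar R)
    (mu rho : R) (X : set R) (t : R) : \bar R :=
  (mu%:E + rho%:E *
   \esum_(s in X `&` [set s : R | s0 < s%:E /\ (s < t)%R]) (g (t - s)%R)%:E)%E.

Definition stationary_process {R : realType} {d : measure_display}
    {Omega : measurableType d} (P : probability Omega R)
    (N : Omega -> set R) : Prop :=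
  forall (h : R) (n : nat) (B : 'I_n -> set R) (Y : 'I_n -> set (\bar R)),
    (forall i, measurable (B i)) -> (forall i, measurable (Y i)) ->
    P [set w | forall i,
         Y i (counting (N w `&` [set x + h | x in B i]))] =
    P [set w | forall i, Y i (counting (N w `&` B i))].

(* s0 finite: the process started empty at s0.  s0 = -oo: the stationary
   process, i.e. the one of finite mean rate. *)
Definition hawkes_process {R : realType} {d : measure_display}
    {Omega : measurableType d} (P : probability Omega R) (g : R -> R)
    (s0 : \bar R) (mu rho : R) (N : Omega -> set R) : Prop :=
  [/\ simple_point_process N,
      forall w s, N w s -> (s0 < s%:E)%E,
      has_stochastic_intensity P N s0
        (fun x => hawkes_intensity g s0 mu rho (N x.2) x.1) &
      s0 = -oo%E ->
        stationary_process P N /\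
        (\int[P]_w counting (N w `&` `]0%R, 1%R]) < +oo)%E].

(* The parameter is v = (log mu, log (1 - rho)). *)
Definition hawkes_param {R : realType} (mu rho : R) : 'rV[R]_2 :=
  \row_(i < 2) if i == 0 then ln mu else ln (1 - rho).

Definition param_intensity {R : realType} (g : R -> R) (s0 : \bar R)
    (v : 'rV[R]_2) (X : set R) (t : R) : \bar R :=
  hawkes_intensity g s0 (expR (v 0 0)) (1 - expR (v 0 1)) X t.

(* The values under "fine" are a.s. finite (at every point of ]0, T] for the
   first one). *)
Definition loglik {R : realType} (g : R -> R) (s0 : \bar R) (T : R)
    (X : set R) (v : 'rV[R]_2) : R :=
  \sum_(t \in X `&` `]0, T]) ln (fine (param_intensity g s0 v X t))
  - fine (\int[@lebesgue_measure R]_(t in `[0%R, T])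
            param_intensity g s0 v X t)%E.

Definition partial {R : realType} (f : 'rV[R]_2 -> R) (v : 'rV[R]_2)
    (i : 'I_2) : R :=
  'D_(delta_mx 0 i : 'rV[R]_2) f v.

Definition score {R : realType} {d : measure_display}
    {Omega : measurableType d} (N : Omega -> set R) (g : R -> R)
    (s0 : \bar R) (T : R) (v : 'rV[R]_2) (i : 'I_2) (w : Omega) : R :=
  partial (loglik g s0 T (N w)) v i.

Definition fisher_info {R : realType} {d : measure_display}
    {Omega : measurableType d} (P : probability Omega R)
    (N : Omega -> set R) (g : R -> R) (s0 : \bar R) (T : R) (v : 'rV[R]_2)
    : 'M[\bar R]_2 :=
  \matrix_(i, j) covariance P (score N g s0 T v i) (score N g s0 T v j).

(* E int_0^T (grad lam) (grad lam)^T / lam dt *)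
Definition fisher_info_intensity {R : realType} {d : measure_display}
    {Omega : measurableType d} (P : probability Omega R)
    (N : Omega -> set R) (g : R -> R) (s0 : \bar R) (T : R) (v : 'rV[R]_2)
    : 'M[\bar R]_2 :=
  \matrix_(i, j)
    (\int[P]_w \int[@lebesgue_measure R]_(t in `[0%R, T])
       (let lam u := fine (param_intensity g s0 u (N w) t) in
        (partial lam v i * partial lam v j / lam v)%R)%:E)%E.

(* Schur complements; with x / 0 = 0 they are meaningful only when the
   denominator is nonzero. *)
Definition eff_info_log_mu {R : realType} (J : 'M[R]_2) : R :=
  J 0 0 - J 0 1 ^+ 2 / J 1 1.

Definition eff_info_log_1rho {R : realType} (J : 'M[R]_2) : R :=
  J 1 1 - J 0 1 ^+ 2 / J 0 0.

Definition sym_mx2 {R : realType} (x y z : R) : 'M[R]_2 :=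
  \matrix_(i, j) if i != j then y else if i == 0 then x else z.

(* Main.v *)
Require Import Defs.
From HB Require Import structures.
From mathcomp Require Import all_boot all_order all_algebra.
From mathcomp Require Import all_classical all_reals all_analysis.
From mathcomp Require Import measurable_realfun ring lra finmap.

Set Implicit Arguments.
Unset Strict Implicit.
Unset Printing Implicit Defensive.
Import Order.TTheory GRing.Theory Num.Theory.
Import numFieldNormedType.Exports.
Local Open Scope classical_set_scope.
Local Open Scope ring_scope.

(** Write E(t) for the excitation, the sum of g (t - s) over the points s
    before t, so that lambda = mu + rho E.  Along the coordinate line of
    log mu the derivative of lambda at the true parameter is mu, along that
    of log (1 - rho) it is - (1 - rho) E.  The score, namely the sum of
    (d lambda) / lambda over the points minus the integral of d lambda, is
    therefore, up to the sign -1 for log (1 - rho), the integral of a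
    predictable weight psi against N(dt) - lambda dt, where
      psi_0 = mu / lambda  and  psi_1 = (1 - rho) E / lambda.
    Both weights lie between 0 and 1 / rho.

    The scores are centered by the Campbell formula, and their covariance is
    the mean of the integral of psi_i psi_j lambda ([compensated_covariance]).
    This isometry follows from the Campbell formula alone.  For a weight f
    let J be its sum over the points and C its integral against lambda dt.
    Ordering the pairs of times by their larger element turns J^2, J C and
    C^2 into sums over points and integrals of f multiplied by the running
    sum or the running integral of f, which are again predictable; the
    Campbell formula then makes everything in the mean of (J - C)^2 cancel
    except the mean of the integral of f^2 lambda ([second_moment_cancel]).
    The cancellation requires finite second moments.  They hold when f is cut
    after the first n points of the window, because J is then bounded; Fatou
    gives one inequality for f itself and the triangle inequality, applied to
    the part cut off, gives the other ([compensated_isometry]).  Polarisation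
    gives the covariance.

    It remains to compute the means Q_ij of the integral of
    psi_i psi_j lambda.  From lambda = mu + rho E,
      rho psi_1 + (1 - rho) psi_0 = 1 - rho.
    Multiplied by lambda and by psi_j lambda, this relation determines
    every Q_ij from Q_00, from the mean F of the integral of lambda, and from
    the integral of psi_0 lambda = mu.  As psi_0^2 lambda = mu psi_0, Q_00 is
    T mu B, while F = T mu D / (1 - rho); this is the asserted matrix.

    Two facts on means complete the argument.  F is finite: for the process
    started empty each point excites on average at most rho further points in
    the window, so that F is at most mu / (1 - rho) times the length of the
    history ([mean_intensity_started_empty]); for the stationary process
    F = mu T + rho F ([mean_count_stationary]), which is also the identity
    D = 1.  And B > 0 ([baseline_weight2_gt0]).  The efficient
    informations follow from the matrix by algebra.

    The intensity may be infinite, but almost surely only at a null set of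
    times; the weights vanish there. *)

(** * Integrals as suprema over simple functions *)

Section integral_comparison.
Local Open Scope ereal_scope.
Context d (T : measurableType d) (R : realType) (mu : {measure set T -> \bar R}).
Import HBNNSimple.

(** The integral of a nonnegative function is the supremum over the simple
    functions below it, and there are more of these below g than below f. *)
Lemma ge0_le_integral_set (D : set T) (f g : T -> \bar R) :
  (forall x, D x -> 0 <= f x) -> (forall x, D x -> f x <= g x) ->
  \int[mu]_(x in D) f x <= \int[mu]_(x in D) g x.
Proof.
move=> f0 fg; rewrite !ge0_integralE//; last first.
  by move=> x Dx; exact: le_trans (f0 _ Dx) (fg _ Dx).
apply: ereal_sup_le => _ [h /= hf <-]; exists h => //= x.
apply: (le_trans (hf x)); rewrite /patch; case: ifPn => // /set_mem Dx.
exact: fg.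
Qed.

(** A simple function below f may be set to zero on a measurable null set
    containing the points where f and g differ: its integral is unchanged and
    it is now below g. *)
Lemma ge0_le_integral_ae (f g : T -> \bar R) :
  (forall x, 0 <= f x) -> (forall x, 0 <= g x) ->
  {ae mu, forall x, f x = g x} ->
  \int[mu]_x f x <= \int[mu]_x g x.
Proof.
move=> f0 g0 [Z [mZ Z0 sub]]; rewrite !ge0_integralTE//.
apply: ge_ereal_sup => _ [h /= hf <-].
have -> : sintegral mu h = \int[mu]_x (h x)%:E by rewrite integralT_nnsfun.
have mh : measurable_fun [set: T] (EFin \o h).
  exact/measurable_EFinP/measurable_funP.
rewrite (ge0_negligible_integral mZ measurableT mh _ Z0); last first.
  by move=> x _; rewrite /= lee_fin.
rewrite integral_nnsfun ?setTD; last exact: measurableC.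
rewrite mrestrict; first exact: measurableC.
move=> mZ'; apply: ereal_sup_ubound; exists (proj_nnsfun h mZ') => //= x.
rewrite /mindic/= indicE; case: (boolP (x \in ~` Z)) => [/set_mem xZ|_].
  rewrite mulr1; have -> : g x = f x; last exact: hf.
  by apply/esym; apply: contrapT => fg; apply: xZ; apply: sub.
by rewrite mulr0.
Qed.

Lemma ge0_eq_integral_ae (f g : T -> \bar R) :
  (forall x, 0 <= f x) -> (forall x, 0 <= g x) ->
  {ae mu, forall x, f x = g x} ->
  \int[mu]_x f x = \int[mu]_x g x.
Proof.
move=> f0 g0 fg; apply/eqP; rewrite eq_le !ge0_le_integral_ae//.
by apply: filterS fg => x ->.
Qed.

Lemma eq_integral_ae (f g : T -> \bar R) :
  {ae mu, forall x, f x = g x} ->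
  \int[mu]_x f x = \int[mu]_x g x.
Proof.
move=> fg; rewrite [LHS]integralE [RHS]integralE; congr (_ - _);
  apply: ge0_eq_integral_ae => //; apply: filterS fg => x fgx;
  by rewrite ?funeposE ?funenegE fgx.
Qed.

Lemma eq_integral_ae_set (D : set T) (f g : T -> \bar R) :
  {ae mu, forall x, D x -> f x = g x} ->
  \int[mu]_(x in D) f x = \int[mu]_(x in D) g x.
Proof.
move=> fg; rewrite integral_mkcond [RHS]integral_mkcond.
apply: eq_integral_ae; apply: filterS fg => x fgx.
by rewrite /patch; case: ifPn => // /set_mem /fgx.
Qed.

End integral_comparison.

(** * Translations and reflections of the Lebesgue measure *)

Section lebesgue_affine.
Local Open Scope ereal_scope.
Context (R : realType).
Local Notation mu := (@lebesgue_measure R).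

Lemma lebesgue_measure_shift (c : R) (A : set R) : measurable A ->
  pushforward mu (fun x : R => x + c : measurableTypeR R)%R A = mu A.
Proof.
move=> mA.
have mf : measurable_fun [set: measurableTypeR R] (fun x : R => x + c : measurableTypeR R)%R.
  exact: measurable_funD.
apply/esym/lebesgue_measure_unique => //= _ [[a b]] _ <-.
rewrite /pushforward /=.
have -> : (fun x : R => x + c : measurableTypeR R)%R @^-1` `]a, b] =
    `](a - c)%R, (b - c)%R]%classic.
  by apply/seteqP; split => x /=; rewrite !in_itv/= ltrBlDr lerBrDr.
rewrite !lebesgue_measure_itv/= !lte_fin ltrD2r.
by rewrite -!EFinB opprB addrA addrNK.
Qed.

Lemma ge0_integral_shift (c : R) (f : R -> \bar R) :
  measurable_fun [set: R] f -> (forall r, 0 <= f r) ->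
  \int[mu]_r f (r + c)%R = \int[mu]_r f r.
Proof.
move=> mf f0.
have mg : measurable_fun [set: measurableTypeR R] (fun x : R => x + c : measurableTypeR R)%R.
  exact: measurable_funD.
rewrite -[LHS](ge0_integral_pushforward mg mu measurableT (f := f))//.
by apply: eq_measure_integral => //= A mA _; exact: lebesgue_measure_shift.
Qed.

Lemma ge0_integral_opp (f : R -> \bar R) :
  measurable_fun [set: R] f -> (forall r, 0 <= f r) ->
  \int[mu]_r f (- r)%R = \int[mu]_r f r.
Proof.
move=> mf f0.
have mg : measurable_fun [set: measurableTypeR R] (-%R : R -> measurableTypeR R).
  exact: measurable_funN.
rewrite -[LHS](ge0_integral_pushforward mg mu measurableT (f := f))//.
by apply: eq_measure_integral => //= A mA _; exact: lebesgue_measureN.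
Qed.

Lemma ge0_integral_reflect (c : R) (f : R -> \bar R) :
  measurable_fun [set: R] f -> (forall r, 0 <= f r) ->
  \int[mu]_r f (c - r)%R = \int[mu]_r f r.
Proof.
move=> mf f0.
rewrite (ge0_integral_opp (f := fun r => f (c + r)%R))//.
  under eq_integral do rewrite addrC.
  exact: ge0_integral_shift.
apply: measurableT_comp => //; exact: measurable_funD.
Qed.

End lebesgue_affine.

(** * Integration against a kernel that is finite at each point *)

Section pointwise_finite_kernel.
Local Open Scope ereal_scope.
Context d d' (X : measurableType d) (Y : measurableType d') (R : realType).
Import HBNNSimple.

(** The sections of a level set of k have measurable mass because each l x is
    bounded, although not uniformly in x.  The kernel used below is the
    counting measure of the points before the current time, whose mass is
    finite but unbounded. *)
Lemma measurable_fun_integral_ptfinite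
    (l : X -> {measure set Y -> \bar R})
    (ml : forall U, measurable U -> measurable_fun [set: X] (l ^~ U))
    (lfin : forall x, l x [set: Y] < +oo)
    (k : X * Y -> \bar R) :
  (forall z, 0 <= k z) -> measurable_fun [set: X * Y] k ->
  measurable_fun [set: X] (fun x => \int[l x]_y k (x, y)).
Proof.
move=> k0 mk.
pose K : R.-ker X ~> Y := HB.pack l (isKernel.Build _ _ _ _ _ l ml).
pose k_ := nnsfun_approx measurableT mk.
apply: (@measurable_fun_xsection_integral _ _ _ _ _ _ _ k_).
- by move=> a b ab; exact/nd_nnsfun_approx.
- by move=> z; exact/cvg_nnsfun_approx.
- move => n r.
  have mA : measurable (k_ n @^-1` [set r]) by exact: measurable_sfunP.
  have := @measurable_prod_subset_xsection_kernel _ _ X Y R K setT measurableT.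
  have bd : forall x, exists M : R, forall U, measurable U ->
      mrestr (K x) measurableT U < M%:E.
    move=> x; exists (fine (l x setT) + 1)%R => U mU.
    rewrite /mrestr setIT EFinD fineK; last first.
      by rewrite ge0_fin_numE.
    apply: (@le_lt_trans _ _ (l x setT)).
      by apply: le_measure; rewrite ?in_setE.
    by rewrite lteDl ?lte_fin// ge0_fin_numE.
  move=> /(_ bd _ mA) /= [_].
  by under eq_fun do rewrite /mrestr setIT.
Qed.

End pointwise_finite_kernel.

(** * Finite sums over the points of a configuration *)

Section finite_esum.
Local Open Scope ereal_scope.
Context (R : realType) (T : choiceType).

Lemma esum_fset_set (A : set T) (f : T -> \bar R) : finite_set A ->
  (forall x, A x -> 0 <= f x) ->
  \esum_(x in A) f x = \sum_(x <- fset_set A) f x.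
Proof. by move=> fA f0; rewrite esum_fset ?fsbig_finite// => i /set_mem; exact: f0. Qed.

Lemma mem_fset_set (A : set T) x : finite_set A ->
  reflect (A x) (x \in fset_set A).
Proof. by move=> fA; rewrite in_fset_set//; apply: (iffP idP) => [/set_mem//|?]; exact: mem_set. Qed.

Lemma counting_esum (A : set T) : finite_set A ->
  (counting A : \bar R) = \esum_(x in A) 1.
Proof.
move=> fA; rewrite esum_fset_set// /counting asboolT//.
by rewrite sumEFin big_const_seq count_predT iter_addr addr0.
Qed.

Lemma le_counting (A B : set T) : finite_set B -> A `<=` B ->
  (counting A : \bar R) <= counting B.
Proof.
move=> fB AB; have fA := sub_finite_set AB fB.
rewrite /counting !asboolT// lee_fin ler_nat; apply: fsubset_leq_card.
by rewrite -fset_set_sub.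
Qed.
End finite_esum.

(** * The predictable sigma-algebra as a measurable type *)

Section predictable_algebra.
Context (R : realType) (d : measure_display) (Omega : measurableType d)
  (N : Omega -> set R) (s0 : \bar R).

Definition predictable_rectangle : set (set (R * Omega)) :=
  [set S | exists a b : R, exists A : set Omega,
     [/\ (s0 <= a%:E)%E, a < b, history N a A & S = `]a, b] `*` A]].

(** A copy of R * Omega on which measurability means predictability, so that
    the closure properties of measurable functions apply to predictable
    ones. *)
Definition predictableT := g_sigma_algebraType predictable_rectangle.

Lemma predictable_funP (C : R * Omega -> \bar R) :
  predictable_fun N s0 C <-> measurable_fun [set: predictableT] (C : predictableT -> \bar R).
Proof.
split=> [pC _ Y mY|mC Y mY]; first by rewrite setTI; exact: pC.
by have := mC measurableT Y mY; rewrite setTI.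
Qed.

Lemma history_measurable t A : simple_point_process N -> history N t A ->
  measurable A.
Proof.
move=> [_ mN]; apply: (smallest_sub (@sigma_algebra_measurable _ Omega)).
move=> _ [B [Y [mB _ mY ->]]]; have := mN B mB measurableT Y mY.
by rewrite setTI.
Qed.

Lemma historyT t : history N t setT.
Proof.
rewrite -setC0; apply: sigma_algebraC; exact: sigma_algebra0.
Qed.

Lemma measurable_predictableT_prod : simple_point_process N ->
  measurable_fun [set: R * Omega] (id : R * Omega -> predictableT).
Proof.
move=> sN; apply: (@measurability _ _ (R * Omega)%type predictableT setT id
  predictable_rectangle erefl).
move=> _ [_ [a [b [A [_ _ hA ->]]]] <-]; rewrite setTI preimage_id.
by apply: measurableX => //; exact: history_measurable hA.
Qed.

Lemma measurable_after b A : (s0 <= b%:E)%E -> history N b A ->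
  measurable ([set x | b < x.1 /\ A x.2] : set predictableT).
Proof.
move=> s0b hA; rewrite [X in measurable X](_ : _ =
    \bigcup_n (`]b, b + n.+1%:R] `*` A : set predictableT)).
  apply: bigcup_measurable => n _; apply: sub_sigma_algebra.
  by exists b, (b + n.+1%:R), A; split => //; rewrite ltrDl.
apply/seteqP; split => [[u w] /= [bu Aw]|[u w] /= [n _] [] /=]; last first.
  by rewrite in_itv/= => /andP[].
exists (Num.truncn (u - b)) => //; split => //=; rewrite in_itv/= bu/=.
by rewrite -lerBlDl ltW// truncnS_gt.
Qed.

(** Predictable rectangles start at s0 or later, so they do not separate the
    times before s0; the clock is measurable once it is stopped from below at
    some b after s0. *)
Lemma measurable_time b : (s0 <= b%:E)%E ->
  measurable_fun [set: predictableT] (fun x : predictableT => Num.max b x.1).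
Proof.
move=> s0b; apply: (measurability _ (RGenOInfty.measurableE R)) => //.
move=> _ [_ [q ->] <-]; rewrite setTI.
have [qb|bq] := ltP q b.
  rewrite (_ : _ @^-1` _ = setT)//; apply/seteqP; split => // x _ /=.
  by rewrite in_itv/= andbT lt_max qb.
rewrite (_ : _ @^-1` _ = [set x : R * Omega | q < x.1 /\ setT x.2]).
  apply: measurable_after; last exact: historyT.
  by rewrite (le_trans s0b)// lee_fin.
apply/seteqP; split => x /=; rewrite in_itv/= andbT lt_max.
  by rewrite ltNge bq/=.
by move=> [-> _]; rewrite orbT.
Qed.

Context (sN : simple_point_process N).

Lemma finite_window w a b : finite_set (N w `&` `]a, b[).
Proof.
apply: sub_finite_set (sN.1 w a b) => x /= [Nx]; rewrite !in_itv/=.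
by move=> /andP[/ltW -> /ltW ->].
Qed.

Lemma finite_windowc w a b : finite_set (N w `&` `]a, b]).
Proof.
apply: sub_finite_set (sN.1 w a b) => x /= [Nx]; rewrite !in_itv/=.
by move=> /andP[/ltW -> ->].
Qed.

(** Left-continuity of u |-> #(B `&` ]b, u[): it is the supremum over the
    rationals r in [b, u[ of the counts in ]b, r], and each of these is known at
    time r, so that its product with the indicator of u > r is predictable. *)
Lemma measurable_count_before b (B : set R) : (s0 <= b%:E)%E -> measurable B ->
  measurable_fun [set: predictableT]
    (fun x : predictableT => counting ((N x.2 `&` B) `&` `]b, x.1[) : \bar R).
Proof.
move=> s0b mB.
(* q enumerates the rationals, with junk value 0 outside the range of pickle *)
pose q (i : nat) : R := ratr (odflt 0 (choice.unpickle i : option rat)).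
pose f (i : nat) (x : predictableT) : \bar R :=
  ((fun x : predictableT => counting (N x.2 `&` (B `&` `]b, q i])) : \bar R) \_
    ([set x | b <= q i < x.1] : set predictableT)) x.
have mf i : measurable_fun [set: predictableT] (f i).
  have mE : measurable ([set x | b <= q i < x.1] : set predictableT).
    case: (lerP b (q i)) => bq /=; last first.
      by rewrite [X in measurable X](_ : _ = set0)//; apply/seteqP; split => x //.
    rewrite [X in measurable X](_ : _ = [set x | q i < x.1 /\ setT x.2]).
      apply: measurable_after; last exact: historyT.
      by rewrite (le_trans s0b)// lee_fin.
    by apply/seteqP; split => x /=; tauto.
  apply/(measurable_restrictT _ mE) => _ Y mY.
  case: (lerP b (q i)) => bq /=; last first.
    by rewrite [X in measurable X](_ : _ = set0)//; apply/seteqP; split => x // [].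
  rewrite [X in measurable X](_ : _ = [set x | q i < x.1 /\
     [set w | Y (counting (N w `&` (B `&` `]b, q i])))] x.2]).
    apply: measurable_after; first by rewrite (le_trans s0b)// lee_fin.
    apply: sub_sigma_algebra; exists (B `&` `]b, q i]), Y; split => //.
      exact: measurableI.
    by move=> x [_ /=]; rewrite !in_itv/= => /andP[].
  by apply/seteqP; split => x /=; tauto.
rewrite (_ : (fun x => _) = (fun x => esups (f ^~ x) 0)).
  exact: measurable_fun_esups.
apply/funext => -[u w] /=; apply/eqP; rewrite eq_le; apply/andP; split.
- rewrite /esups/= /sdrop.
  pose F := fset_set ((N w `&` B) `&` `]b, u[).
  have fF : finite_set ((N w `&` B) `&` `]b, u[).
    by apply: sub_finite_set (finite_window w b u) => x [[]].
  have [ub|bu] := leP u b.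
    rewrite (_ : _ `&` _ = set0); last first.
      apply/seteqP; split => // x [_ /=]; rewrite in_itv/= => /andP[bx xu].
      by have := lt_trans bx xu; rewrite ltNge ub.
    rewrite measure0; apply: le_ereal_sup_tmp; exists (f 0%N (u, w)) => /=.
      by exists 0%N.
    by rewrite /f /patch; case: ifPn => // _; exact: measure_ge0.
  (* any rational between the last point before u and u itself realises the
     supremum *)
  pose m := \big[Num.max/b]_(x <- F) x.
  have mu : m < u.
    rewrite /m big_seq; apply: bigmax_lt => // i /(mem_fset_set _ fF) [_ /=].
    by rewrite in_itv/= => /andP[].
  have [r] := rat_in_itvoo mu; rewrite in_itv/= => /andP[mr ru].
  have qr : q (choice.pickle r) = ratr r by rewrite /q choice.pickleK.
  have bm : b <= m.
    by rewrite /m; elim/big_rec: _ => // x y _ bx; rewrite le_max bx orbT.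
  apply: le_ereal_sup_tmp; exists (f (choice.pickle r) (u, w)).
    by exists (choice.pickle r).
  rewrite /f /patch mem_set/= ?qr ?ru ?andbT; last by rewrite (le_trans bm)// ltW.
  apply: le_counting.
    by apply: sub_finite_set (finite_windowc w b (ratr r)) => x [? []].
  move=> x Fx; have [[Nx Bx] /=] := Fx; rewrite in_itv/= => /andP[bx xu].
  split => //; split => //=; rewrite in_itv/= bx/=.
  apply: le_trans (ltW mr); rewrite /m; apply: le_bigmax_seq => //.
  exact/mem_fset_set.
- apply: ge_ereal_sup => _ [i _ <-]; rewrite /f /patch; case: ifPn => [|_].
    move=> /set_mem /= /andP[bq qu]; apply: le_counting.
      by apply: sub_finite_set (finite_window w b u) => x [[]].
    move=> x [Nx [Bx /=]]; rewrite !in_itv/= => /andP[bx xq]; split => //=; rewrite ?in_itv/=.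
    by rewrite bx (le_lt_trans xq).
  exact: measure_ge0.
Qed.

End predictable_algebra.

(** * The counting measure of a finite list of points *)

Section point_measure.
Local Open Scope ereal_scope.
Context (R : realType).

Definition point_measure (s : seq R) :
    {measure set R -> \bar R} :=
  msum (fun i => \d_(nth 0%R s i) : {measure set R -> \bar R}) (size s).

Lemma point_measureE (s : seq R) (U : set R) :
  point_measure s U = \sum_(x <- s) (\1_U x)%:E.
Proof.
rewrite /point_measure /msum/= (big_nth 0%R) big_mkord.
by apply: eq_bigr => i _; rewrite /= diracE indicE.
Qed.

Lemma integral_point_measure (s : seq R) (f : R -> \bar R) :
  (forall x, 0 <= f x) -> measurable_fun [set: R] f ->
  \int[point_measure s]_x f x = \sum_(x <- s) f x.
Proof.
move=> f0 mf; rewrite /point_measure ge0_integral_measure_sum//.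
rewrite (big_nth 0%R) big_mkord.
by apply: eq_bigr => i _; rewrite /= integral_dirac// diracT mul1e.
Qed.

End point_measure.

(** * Running sums and running integrals are predictable *)

Section running.
Local Open Scope ereal_scope.
Context (R : realType) (d : measure_display) (Omega : measurableType d)
  (N : Omega -> set R) (s0 : \bar R).

Definition running_sum (b : R) (f : R * Omega -> \bar R) (x : R * Omega) :=
  \esum_(t in N x.2 `&` `]b, x.1[) f (t, x.2).

Definition running_integral (b : R) (f : R * Omega -> \bar R)
    (x : R * Omega) :=
  \int[@lebesgue_measure R]_(t in `]b, x.1[) f (t, x.2).

Context (sN : simple_point_process N) (b : R) (s0b : s0 <= b%:E).
Local Notation predictableT := (predictableT N s0).

(* Pairs of a current time and outcome with an earlier time; on them,
   evaluating a predictable function at the earlier time is jointly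
   measurable, because the history up to the earlier time is known at the
   current one. *)
Let past : set (predictableT * R) := [set z | (b < z.2 < Num.max b z.1.1)%R].
Let rebase (z : predictableT * R) : predictableT := (z.2, z.1.2).

Let measurable_past : measurable past.
Proof.
have mt : measurable_fun [set: predictableT * R] (fun z => Num.max b z.1.1).
  by apply: (@measurableT_comp _ _ _ (predictableT * R)%type predictableT R
    (fun x : predictableT => Num.max b x.1) setT fst);
    [exact: measurable_time|exact: measurable_fst].
have m2 : measurable_fun [set: predictableT * R] snd by exact: measurable_snd.
rewrite [X in measurable X](_ : _ =
   [set z | (b < z.2)%R] `&` [set z : predictableT * R | (z.2 < Num.max b z.1.1)%R]).
  apply: measurableI.
  - rewrite -[X in measurable X]setTI.
    exact: (measurable_fun_ltr (measurable_cst b) m2 measurableT (Y := [set true])).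
  - rewrite -[X in measurable X]setTI.
    exact: (measurable_fun_ltr m2 mt measurableT (Y := [set true])).
by apply/seteqP; split => z /=; [move=> /andP[]|move=> [? ?]; exact/andP].
Qed.

Let measurable_rebase : measurable_fun past rebase.
Proof.
apply: (@measurability _ _ (predictableT * R)%type predictableT past rebase
  (predictable_rectangle N s0) erefl).
move=> _ [_ [a [c [A [s0a ac hA ->]]]] <-].
rewrite [X in measurable X](_ : _ = past `&`
    ((fst @^-1` [set x : R * Omega | (a < x.1)%R /\ A x.2]) `&` (snd @^-1` `]a, c]))).
  apply: measurableI; first exact: measurable_past.
  apply: measurableI.
    rewrite -[X in measurable X]setTI.
    apply: measurable_fst => //; exact: measurable_after.
  by rewrite -[X in measurable X]setTI; apply: measurable_snd.
apply/seteqP; split => -[[u w] r] /= [pz]; last by move=> [[au Aw] arc].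
move=> [arc Aw]; split => //; split => //; split => //.
move: pz arc; rewrite /past/= in_itv/= lt_max => /andP[br /orP[rb|ru]] /andP[ar _].
  by have := lt_trans br rb; rewrite ltxx.
exact: lt_trans ru.
Qed.

Let past_fun (f : R * Omega -> \bar R) := (f \o rebase) \_ past.

Let past_funE f x t :
  past_fun f (x, t) = ((fun t => f (t, x.2)) \_ `]b, x.1[) t.
Proof.
rewrite /past_fun /patch; congr (if _ then _ else _).
apply/idP/idP => /set_mem; rewrite /past/= => h; apply/mem_set; move: h => /=.
  rewrite in_itv/= lt_max => /andP[bt /orP[tb|->]]; last by rewrite bt.
  by have := lt_trans bt tb; rewrite ltxx.
by rewrite in_itv/= lt_max => /andP[-> ->]; rewrite orbT.
Qed.

Let past_fun_ge0 f : (forall x, 0 <= f x) -> forall z, 0 <= past_fun f z.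
Proof. by move=> f0 z; rewrite /past_fun /patch; case: ifPn => // _; exact: f0. Qed.

Let measurable_past_fun f : measurable_fun [set: predictableT] (f : predictableT -> \bar R) ->
  measurable_fun [set: predictableT * R] (past_fun f).
Proof.
move=> mf; apply/(measurable_restrictT _ measurable_past).
by apply: (measurableT_comp mf); exact: measurable_rebase.
Qed.

Lemma measurable_running_integral f : (forall x, 0 <= f x) ->
  measurable_fun [set: predictableT] (f : predictableT -> \bar R) ->
  measurable_fun [set: predictableT] (running_integral b f : predictableT -> \bar R).
Proof.
move=> f0 mf.
have := @measurable_fun_fubini_tonelli_F _ _ predictableT (measurableTypeR R) R
  (@lebesgue_measure R)
  (past_fun f) (measurable_past_fun mf) (past_fun_ge0 f0).
congr (measurable_fun _ _); apply/funext => x.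
rewrite /fubini_F /running_integral [RHS]integral_mkcond.
by apply: eq_integral => t _; rewrite past_funE.
Qed.

(** A sum over the points before the current time is an integral against the
    kernel of the counting measures of these points. *)
Lemma measurable_running_sum f : (forall x, 0 <= f x) ->
  measurable_fun [set: predictableT] (f : predictableT -> \bar R) ->
  measurable_fun [set: predictableT] (running_sum b f : predictableT -> \bar R).
Proof.
move=> f0 mf.
pose l (x : predictableT) := point_measure (fset_set (N x.2 `&` `]b, x.1[)).
have ml U : measurable U -> measurable_fun [set: predictableT] (l ^~ U).
  move=> mU; have := measurable_count_before sN s0b mU.
  congr (measurable_fun _ _); apply/funext => x.
  have fx := finite_window sN x.2 b x.1.
  rewrite /l point_measureE counting_esum; last first.
    by apply: sub_finite_set fx => y [[]].
  rewrite (_ : _ `&` _ = (N x.2 `&` `]b, x.1[) `&` U); last first.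
    by rewrite setIAC.
  rewrite esum_mkcondr esum_fset_set//; last first.
    by move=> y _; case: ifPn.
  by apply: eq_bigr => y _; rewrite indicE; case: (y \in U).
have lfin x : l x [set: R] < +oo.
  by rewrite /l point_measureE sumEFin ltry.
have := measurable_fun_integral_ptfinite ml lfin (past_fun_ge0 f0)
  (measurable_past_fun mf).
congr (measurable_fun _ _); apply/funext => x.
have fx := finite_window sN x.2 b x.1.
rewrite integral_point_measure//; last 2 first.
- by move=> t; exact: past_fun_ge0.
- exact: measurableT_comp (measurable_past_fun mf) (pair1_measurable x).
rewrite /running_sum esum_fset_set// big_seq [RHS]big_seq.
apply: eq_bigr => t /(mem_fset_set _ fx) [_ tx].
by rewrite past_funE /patch mem_set.
Qed.

End running.

(** * Products of sums and integrals, ordered in time *)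

Lemma measurable_fun_indicator d (T : measurableType d) (R : realType)
    (D : set T) (f : T -> bool) : measurable D -> measurable_fun D f ->
  measurable_fun D (fun x => (f x)%:R%:E : \bar R).
Proof.
move=> mD mf; rewrite (_ : (fun x => _) = (fun x => if f x then 1%E else 0%E)).
  exact: measurable_fun_if.
by apply/funext => x; case: (f x).
Qed.

Section pathwise_products.
Local Open Scope ereal_scope.
Context (R : realType).
Local Notation mu := (@lebesgue_measure R).

(** Each pair of distinct entries occurs in the square once in each order. *)
Lemma sum_sqr_ordered (s : seq R) (f : R -> \bar R) : uniq s ->
  (forall x, 0 <= f x) ->
  (\sum_(x <- s) f x) * (\sum_(x <- s) f x) =
  \sum_(x <- s) f x * f x +
  2%:E * \sum_(x <- s) f x * \sum_(y <- s | (y < x)%R) f y.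
Proof.
move=> us f0.
have sf0 P : 0 <= \sum_(y <- s | P y) f y by exact: sume_ge0.
pose lower := \sum_(x <- s) f x * \sum_(y <- s | (y < x)%R) f y.
have lower0 : 0 <= lower by apply: sume_ge0 => x _; exact: mule_ge0.
have -> : 2%:E * lower = lower + lower.
  by rewrite -{1}[2%R]/(1 + 1)%R EFinD ge0_muleDl// mul1e.
have upper : \sum_(x <- s) f x * \sum_(y <- s | (x < y)%R) f y = lower.
  under eq_bigr => x _ do rewrite ge0_sume_distrr//.
  rewrite (exchange_big_dep xpredT)//= /lower.
  apply: eq_bigr => y _; rewrite ge0_sume_distrr//.
  by apply: eq_bigr => x _; rewrite muleC.
rewrite ge0_sume_distrl//.
rewrite -{2}upper addeA -!big_split/= big_seq [RHS]big_seq.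
apply: eq_bigr => x xs.
rewrite -!ge0_muleDr ?adde_ge0//; congr (_ * _).
rewrite (bigID (fun y => (y < x)%R))/= (bigID (fun y => (x < y)%R) (fun y => ~~ (y < x)%R))/=.
have -> : \sum_(y <- s | ~~ (y < x)%R && (x < y)%R) f y =
    \sum_(y <- s | (x < y)%R) f y by apply: eq_bigl => y; case: ltgtP.
have -> : \sum_(y <- s | ~~ (y < x)%R && ~~ (x < y)%R) f y = f x.
  rewrite (big_rem x)//= ltxx/= big1_seq ?adde0// => y /andP[/andP[yx xy]].
  rewrite mem_rem_uniq// inE => /andP[/eqP yneqx _].
  by case: (ltgtP y x) yx xy yneqx.
by rewrite addrA [LHS]addrC [LHS]addrA.
Qed.

Context (b c : R) (g : R -> \bar R) (mg : measurable_fun `]b, c] g)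
  (g0 : forall t, 0 <= g t).

(** Pairs made of a point x and a time u are split according to which of them
    comes last. *)
Lemma mul_sum_integral (s : seq R) (f : R -> \bar R) :
  (forall x, x \in s -> (b < x <= c)%R) -> (forall x, 0 <= f x) ->
  (\sum_(x <- s) f x) * \int[mu]_(u in `]b, c]) g u =
  \sum_(x <- s) f x * \int[mu]_(u in `]b, x[) g u +
  \int[mu]_(u in `]b, c]) ((\sum_(x <- s | (x < u)%R) f x) * g u).
Proof.
move=> sbc f0.
have split_at x : x \in s -> \int[mu]_(u in `]b, c]) g u =
    \int[mu]_(u in `]b, x[) g u + \int[mu]_(u in `]b, c]) ((x < u)%R%:R%:E * g u).
  move=> /sbc/andP[bx xc].
  have bxc : `]b, x] `<=` `]b, c].
    by move=> t /=; rewrite !in_itv/= => /andP[-> /le_trans->].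
  have xbc : `]x, c] `<=` `]b, c].
    by move=> t /=; rewrite !in_itv/= => /andP[/(lt_trans bx) -> ->].
  have bxc' : `]b, x] `|` `]x, c] = `]b, c]%classic.
    apply/seteqP; split => t; first by case=> [/bxc|/xbc].
    move=> /=; rewrite !in_itv/= => /andP[-> ->]/=.
    by case: (leP t x); [left|right].
  rewrite -{1}bxc' ge0_integral_setU//=; last 2 first.
  - by rewrite bxc'.
  - apply/disj_set2P/seteqP; split => // t [] /=; rewrite !in_itv/=.
    by move=> /andP[_ tx] /andP[xt _]; have := lt_le_trans xt tx; rewrite ltxx.
  congr (_ + _).
    rewrite integral_itv_bndo_bndc//; apply: measurable_funS mg => //.
    by move=> t tx; apply: bxc; move: tx; rewrite /= !in_itv/= => /andP[-> /ltW].
  rewrite -[in LHS](setIidr xbc) integral_mkcondr.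
  apply: eq_integral => t /set_mem /=; rewrite in_itv/= => /andP[_ tc].
  rewrite /patch; case: ifPn => [/set_mem|/negP h] /=.
    by rewrite in_itv/= => /andP[-> _]; rewrite mul1e.
  rewrite (_ : (x < t)%R = false) ?mul0e//; apply/negP => xt; apply: h.
  by apply/mem_set; rewrite /= in_itv/= xt.
have mgx x : measurable_fun `]b, c] (fun u => (x < u)%R%:R%:E * g u).
  by apply: emeasurable_funM => //; apply: measurable_fun_indicator => //;
    exact: measurable_fun_ltr.
have gx0 x u : 0 <= (x < u)%R%:R%:E * g u by rewrite mule_ge0// lee_fin.
rewrite ge0_sume_distrl//.
have -> : \int[mu]_(u in `]b, c]) ((\sum_(x <- s | (x < u)%R) f x) * g u) =
    \sum_(x <- s) f x * \int[mu]_(u in `]b, c]) ((x < u)%R%:R%:E * g u).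
  transitivity (\int[mu]_(u in `]b, c])
      \sum_(x <- s) f x * ((x < u)%R%:R%:E * g u)).
    apply: eq_integral => u _; rewrite ge0_sume_distrl// big_mkcond/=.
    by apply: eq_bigr => x _; case: ifPn => _; rewrite ?mul1e// mul0e mule0.
  rewrite ge0_integral_sum//; last 2 first.
  - by move=> x; apply: measurable_funeM; exact: mgx.
  - by move=> x u _; apply: mule_ge0; [exact: f0|exact: gx0].
  apply: eq_bigr => x _; rewrite ge0_integralZl//; exact: mgx.
rewrite -big_split/= big_seq [RHS]big_seq; apply: eq_bigr => x xs.
by rewrite (split_at x)// ge0_muleDr//; apply: integral_ge0.
Qed.

(** The square is the double integral over ]b, c]^2; the diagonal is null, and
    the two triangles contribute equally by Tonelli. *)
Lemma integral_sqr_ordered :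
  (\int[mu]_(u in `]b, c]) g u) * (\int[mu]_(u in `]b, c]) g u) =
  2%:E * \int[mu]_(u in `]b, c]) ((\int[mu]_(v in `]b, u[) g v) * g u).
Proof.
pose h : R -> \bar R := g \_ `]b, c].
have h0 t : 0 <= h t by rewrite /h /patch; case: ifPn.
have mh : measurable_fun [set: R] h.
  by apply/(measurable_restrictT g); first exact: measurable_itv.
pose k (z : R * R) := (z.2 < z.1)%R%:R%:E * (h z.2 * h z.1).
have k0 z : 0 <= k z by rewrite !mule_ge0// lee_fin.
have mk : measurable_fun [set: R * R] k.
  apply: emeasurable_funM.
    apply: measurable_fun_indicator => //.
    by apply: measurable_fun_ltr; [exact: measurable_snd|exact: measurable_fst].
  apply: emeasurable_funM.
    exact: (measurableT_comp mh measurable_snd).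
  exact: (measurableT_comp mh measurable_fst).
have I0 : 0 <= \int[mu]_u h u by exact: integral_ge0.
have lowE : \int[mu]_(u in `]b, c]) ((\int[mu]_(v in `]b, u[) g v) * g u) =
    \int[mu]_u \int[mu]_v k (u, v).
  rewrite integral_mkcond; apply: eq_integral => u _.
  rewrite /patch; case: ifPn => [ubc|nubc]; last first.
    rewrite integral0_eq// => v _.
    have hu : h u = 0 by rewrite /h /patch (negbTE nubc).
    by rewrite /k/= hu !mule0.
  transitivity ((\int[mu]_v ((v < u)%R%:R%:E * h v)) * g u).
    congr (_ * _); rewrite integral_mkcond; apply: eq_integral => v _.
    rewrite /patch; case: ifPn => [/set_mem|/negP vbu].
      move=> /=; rewrite in_itv/= => /andP[bv vu].
      rewrite vu mul1e /h /patch mem_set//= in_itv/= bv/=.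
      move: ubc => /set_mem; rewrite /= in_itv/= => /andP[_].
      exact: le_trans (ltW vu).
    rewrite /h /patch; case: ifPn => [/set_mem|]; last by rewrite mule0.
    rewrite /= in_itv/= => /andP[bv vc].
    rewrite (_ : (v < u)%R = false) ?mul0e//; apply/negP => vu; apply: vbu.
    by apply/mem_set; rewrite /= in_itv/= bv.
  rewrite -ge0_integralZr//.
  - have hu : h u = g u by rewrite /h /patch ubc.
    by apply: eq_integral => v _; rewrite /k/= hu muleA.
  - by apply: emeasurable_funM => //; apply: measurable_fun_indicator => //;
      exact: measurable_fun_ltr.
  - by move=> v _; rewrite mule_ge0// lee_fin.
have fullE : (\int[mu]_u h u) * (\int[mu]_u h u) =
    \int[mu]_u \int[mu]_v (k (u, v) + k (v, u)).
  rewrite -ge0_integralZr//; apply: eq_integral => u _.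
  rewrite -ge0_integralZl//.
  apply: ge0_eq_integral_ae.
    by move=> v; rewrite mule_ge0.
    by move=> v; rewrite adde_ge0.
  exists [set u]; split; [exact: measurable_set1|exact: lebesgue_measure_set1|].
  move=> v /= uv; apply: contrapT => /eqP vu; apply: uv.
  rewrite /k/=; case: ltgtP vu => // vu _; rewrite mul1e mul0e ?adde0 ?add0e//.
  by rewrite muleC.
rewrite integral_mkcond -/h lowE fullE.
under eq_integral => u _.
  rewrite ge0_integralD//; last 2 first.
    exact: (measurableT_comp mk (pair1_measurable u)).
    exact: (measurableT_comp mk (pair2_measurable u)).
  over.
rewrite ge0_integralD//; last 4 first.
- by move=> u _; exact: integral_ge0.
- exact: (@measurable_fun_fubini_tonelli_F _ _ (measurableTypeR R)
    (measurableTypeR R) R mu k mk k0).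
- by move=> u _; exact: integral_ge0.
- exact: (@measurable_fun_fubini_tonelli_G _ _ (measurableTypeR R)
    (measurableTypeR R) R mu k mk k0).
rewrite -(@fubini_tonelli _ _ (measurableTypeR R) (measurableTypeR R) R mu mu k mk k0).
rewrite -[2%R]/(1 + 1)%R EFinD ge0_muleDl ?mul1e//.
Qed.

End pathwise_products.

(** * The Campbell formula on a window ]b, c] *)

Definition jump_sum (R : realType) (Omega : Type) (N : Omega -> set R)
    (b c : R) (f : R * Omega -> \bar R) (w : Omega) : \bar R :=
  \esum_(t in N w `&` `]b, c]) f (t, w).

Definition compensator (R : realType) (Omega : Type)
    (lam : R * Omega -> \bar R) (b c : R) (f : R * Omega -> \bar R)
    (w : Omega) : \bar R :=
  (\int[@lebesgue_measure R]_(t in `]b, c]) (f (t, w) * lam (t, w)))%E.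

Section campbell.
Local Open Scope ereal_scope.
Context (R : realType) (d : measure_display) (Omega : measurableType d)
  (P : probability Omega R) (N : Omega -> set R) (s0 : \bar R)
  (lam : R * Omega -> \bar R)
  (sN : simple_point_process N)
  (hI : has_stochastic_intensity P N s0 lam)
  (b c : R) (s0b : s0 <= b%:E) (bc : (b <= c)%R).
Local Notation predictableT := (predictableT N s0).
(* The predicate on functions, no longer the sigma-algebra. *)
Local Notation predictable f := (measurable_fun [set: predictableT] (f : predictableT -> \bar R)).
Local Notation jump := (jump_sum N b c).
Local Notation comp := (compensator lam b c).
Implicit Types f g : R * Omega -> \bar R.

Definition mean_intensity f := \int[P]_w compensator lam b c f w.
Local Notation EE := mean_intensity.

Let lam0 x : 0 <= lam x. Proof. by have [] := hI. Qed.

Lemma predictable_intensity : predictable lam.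
Proof. by apply/predictable_funP; have [] := hI. Qed.

Lemma predictable_prod f : predictable f -> measurable_fun [set: R * Omega] f.
Proof.
move=> mf; exact: (@measurableT_comp _ _ _ (R * Omega)%type predictableT (\bar R)
  f setT id mf (@measurable_predictableT_prod _ _ _ N s0 sN)).
Qed.

Lemma predictable_path f w : predictable f ->
  measurable_fun [set: R] (fun t => f (t, w)).
Proof.
by move=> /predictable_prod mf; exact: (measurableT_comp mf (pair2_measurable w)).
Qed.

Let window : set (R * Omega) := `]b, c] `*` setT.

Let measurable_window : measurable (window : set predictableT).
Proof.
rewrite (_ : window = ([set x | (b < x.1)%R /\ setT x.2] : set predictableT) `\`
    ([set x | (c < x.1)%R /\ setT x.2] : set predictableT)).
  apply: measurableD; apply: measurable_after => //; try exact: historyT.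
  by rewrite (le_trans s0b)// lee_fin.
apply/seteqP; split => -[u w].
  move=> [ubc _]; have : u \in `]b, c] by [].
  by rewrite in_itv/= => /andP[bu uc]; split => //= -[]; rewrite ltNge uc.
move=> /= [[bu _] h]; split => //; suff : u \in `]b, c] by [].
by rewrite in_itv/= bu/= leNgt; apply/negP => cu; apply: h.
Qed.

(** Restricting to the window lets the Campbell formula, which concerns all
    points and all times after s0, be applied on ]b, c]. *)
Lemma predictable_window f : predictable f -> predictable (f \_ window).
Proof.
move=> mf; apply/(measurable_restrictT _ measurable_window).
exact: measurable_funTS mf.
Qed.

Lemma jump_sum_campbell f : (forall x, 0 <= f x) -> predictable f ->
  \int[P]_w jump f w = EE f.
Proof.
move=> f0 mf; have [_ _ _ /(_ (f \_ window))] := hI.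
have fw0 x : 0 <= (f \_ window) x by rewrite /patch; case: ifPn.
move=> /(_ fw0).
have /predictable_funP pf := predictable_window mf.
move=> /(_ pf) camp.
transitivity (\int[P]_w \esum_(t in N w) (f \_ window) (t, w)).
  apply: eq_integral => w _; rewrite /jump_sum esum_mkcondr.
  apply: eq_esum => t _; rewrite /patch; congr (if _ then _ else _).
  by apply/idP/idP => /set_mem h; apply/mem_set; [split|case: h].
rewrite camp; apply: eq_integral => w _; rewrite /compensator.
rewrite [LHS]integral_mkcond [RHS]integral_mkcond; apply: eq_integral => t _.
rewrite /patch; case: ifPn => [_|ns0].
  case: ifPn => [/set_mem[/= tbc _]|tw].
    by rewrite mem_set.
  rewrite mul0e memNset// => tbc; move/negP : tw; apply; apply/mem_set.
  by split.
rewrite memNset// => tbc; move/negP : ns0; apply; apply/mem_set => /=.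
move: tbc; rewrite /= in_itv/= => /andP[bt _].
by rewrite (le_lt_trans s0b)// lte_fin.
Qed.

Lemma jump_sum_ge0 f w : (forall x, 0 <= f x) -> 0 <= jump f w.
Proof. by move=> f0; apply: esum_ge0 => t _; exact: f0. Qed.

Lemma compensator_ge0 f w : (forall x, 0 <= f x) -> 0 <= comp f w.
Proof. by move=> f0; apply: integral_ge0 => t _; rewrite mule_ge0. Qed.

Lemma jump_sum_seq f w : (forall x, 0 <= f x) ->
  jump f w = \sum_(t <- fset_set (N w `&` `]b, c])) f (t, w).
Proof. by move=> f0; rewrite /jump_sum esum_fset_set//; exact: finite_windowc. Qed.

(** Evaluate at time c + 1 the running sum of f restricted to the window. *)
Lemma measurable_jump_sum f : (forall x, 0 <= f x) -> predictable f ->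
  measurable_fun [set: Omega] (jump f).
Proof.
move=> f0 mf.
have fw0 x : 0 <= (f \_ window) x by rewrite /patch; case: ifPn.
have := measurable_running_sum sN s0b fw0 (predictable_window mf).
move=> /predictable_prod m.
have := measurableT_comp m (pair1_measurable (c + 1)%R).
congr (measurable_fun _ _); apply/funext => w /=.
rewrite /running_sum /= /jump_sum.
rewrite esum_mkcondr [RHS]esum_mkcondr; apply: eq_esum => t _.
rewrite /patch; case: ifPn => tbc.
  congr (if _ then _ else _).
  by apply/idP/idP => /set_mem h; apply/mem_set; [case: h|split].
rewrite memNset// => tbc'; move/negP: tbc; apply; apply/mem_set => /=.
move: tbc'; rewrite /= !in_itv/= => /andP[-> tc]/=.
by rewrite (le_lt_trans tc)// ltrDl.
Qed.

Lemma measurable_compensator f : (forall x, 0 <= f x) -> predictable f ->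
  measurable_fun [set: Omega] (comp f).
Proof.
move=> f0 mf.
pose h : R * Omega -> \bar R := (f \* lam) \_ window.
have h0 x : 0 <= h x by rewrite /h /patch; case: ifPn => // _; rewrite mule_ge0.
have mh : measurable_fun [set: R * Omega] h.
  apply: predictable_prod; apply: predictable_window.
  exact: emeasurable_funM mf predictable_intensity.
have := @measurable_fun_fubini_tonelli_G _ _ (measurableTypeR R) Omega R
  (@lebesgue_measure R) h mh h0.
congr (measurable_fun _ _); apply/funext => w.
rewrite /fubini_G /compensator [RHS]integral_mkcond; apply: eq_integral => t _.
rewrite /h /patch; congr (if _ then _ else _).
by apply/idP/idP => /set_mem hh; apply/mem_set; [case: hh|split].
Qed.

Lemma mean_intensity_ge0 f : (forall x, 0 <= f x) -> 0 <= EE f.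
Proof. by move=> f0; apply: integral_ge0 => w _; exact: compensator_ge0. Qed.

Lemma le_compensator f g w : (forall x, 0 <= f x) ->
  (forall x, f x <= g x) -> comp f w <= comp g w.
Proof.
move=> f0 fg; apply: ge0_le_integral_set => t _; first by rewrite mule_ge0.
exact: lee_wpmul2r.
Qed.

Lemma le_mean_intensity f g : (forall x, 0 <= f x) ->
  (forall x, f x <= g x) -> EE f <= EE g.
Proof.
move=> f0 fg; apply: ge0_le_integral_set => w _; first exact: compensator_ge0.
exact: le_compensator.
Qed.

Lemma jump_sumD f g w : (forall x, 0 <= f x) -> (forall x, 0 <= g x) ->
  jump (f \+ g) w = jump f w + jump g w.
Proof. by move=> f0 g0; rewrite /jump_sum esumD. Qed.

Lemma compensatorD f g w : (forall x, 0 <= f x) -> (forall x, 0 <= g x) ->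
  predictable f -> predictable g ->
  comp (f \+ g) w = comp f w + comp g w.
Proof.
move=> f0 g0 mf mg; rewrite /compensator -ge0_integralD//.
- by apply: eq_integral => t _; rewrite ge0_muleDl.
- by move=> t _; rewrite mule_ge0.
- apply: measurable_funTS; apply: emeasurable_funM; apply: predictable_path => //.
  exact: predictable_intensity.
- by move=> t _; rewrite mule_ge0.
- apply: measurable_funTS; apply: emeasurable_funM; apply: predictable_path => //.
  exact: predictable_intensity.
Qed.

Lemma mean_intensityD f g : (forall x, 0 <= f x) -> (forall x, 0 <= g x) ->
  predictable f -> predictable g -> EE (f \+ g) = EE f + EE g.
Proof.
move=> f0 g0 mf mg; rewrite /mean_intensity -ge0_integralD//.
- by apply: eq_integral => w _; exact: compensatorD.
- by move=> w _; exact: compensator_ge0.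
- exact: measurable_compensator.
- by move=> w _; exact: compensator_ge0.
- exact: measurable_compensator.
Qed.

Lemma compensatorZ (k : R) f w : (0 <= k)%R -> (forall x, 0 <= f x) ->
  predictable f -> comp (fun x => k%:E * f x) w = k%:E * comp f w.
Proof.
move=> k0 f0 mf; rewrite /compensator -ge0_integralZl//.
- by apply: eq_integral => t _; rewrite muleA.
- apply: measurable_funTS; apply: emeasurable_funM; apply: predictable_path => //.
  exact: predictable_intensity.
- by move=> t _; rewrite mule_ge0.
Qed.

Lemma mean_intensityZ (k : R) f : (0 <= k)%R -> (forall x, 0 <= f x) ->
  predictable f -> EE (fun x => k%:E * f x) = k%:E * EE f.
Proof.
move=> k0 f0 mf; rewrite /mean_intensity -ge0_integralZl//.
- by apply: eq_integral => w _; exact: compensatorZ.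
- exact: measurable_compensator.
- by move=> w _; exact: compensator_ge0.
Qed.

Lemma running_sum_seq f w u : (forall x, 0 <= f x) -> (u <= c)%R ->
  running_sum N b f (u, w) =
  \sum_(s <- fset_set (N w `&` `]b, c]) | (s < u)%R) f (s, w).
Proof.
move=> f0 uc; have fw := finite_windowc sN w b c.
rewrite /running_sum /= [in LHS](_ : _ `&` _ =
    (N w `&` `]b, c]) `&` [set s | (s < u)%R]); last first.
  apply/seteqP; split => s /=; rewrite !in_itv/=.
    move=> [Ns /andP[bs st]]; split => //; split => //.
    by rewrite bs (le_trans (ltW st)).
  by move=> [[Ns /andP[-> _]] ->].
rewrite esum_mkcondr esum_fset_set//; last by move=> s _; case: ifPn.
rewrite [RHS]big_mkcond; apply: eq_bigr => s _; congr (if _ then _ else _).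
by apply/idP/idP => [/set_mem//|st]; apply/mem_set.
Qed.

(** The three products below are the pathwise integration by parts formulas;
    their right-hand sides are sums and integrals of predictable functions, to
    which the Campbell formula applies. *)
Lemma jump_sum_sqr f w : (forall x, 0 <= f x) ->
  jump f w * jump f w =
  jump (f \* f) w + 2%:E * jump (f \* running_sum N b f) w.
Proof.
move=> f0.
have r0 x : 0 <= running_sum N b f x by apply: esum_ge0.
rewrite !jump_sum_seq//; try by move=> x; rewrite mule_ge0.
rewrite (@sum_sqr_ordered _ _ (fun t => f (t, w)))//; last exact: fset_uniq.
congr (_ + 2%:E * _); rewrite big_seq [RHS]big_seq; apply: eq_bigr => t.
have fw := finite_windowc sN w b c.
move=> /(mem_fset_set _ fw) [_ /=]; rewrite in_itv/= => /andP[bt tc].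
by rewrite -(running_sum_seq w f0 tc).
Qed.

Lemma jump_sum_compensator f w : (forall x, 0 <= f x) -> predictable f ->
  jump f w * comp f w =
  jump (f \* running_integral b (f \* lam)) w +
  comp (f \* running_sum N b f) w.
Proof.
move=> f0 mf.
have fw := finite_windowc sN w b c.
have fl0 x : 0 <= (f \* lam) x by rewrite mule_ge0.
have r0 x : 0 <= running_integral b (f \* lam) x by apply: integral_ge0.
rewrite !jump_sum_seq//; last by move=> x; rewrite mule_ge0.
rewrite /compensator (@mul_sum_integral _ b c (fun t => (f \* lam) (t, w)) _ _
  _ (fun t => f (t, w)))//; last 2 first.
- apply: measurable_funTS; apply: emeasurable_funM; apply: predictable_path => //.
  exact: predictable_intensity.
- by move=> t /(mem_fset_set _ fw) [_ /=]; rewrite in_itv.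
congr (_ + _); apply: eq_integral => u /set_mem /=.
rewrite in_itv/= => /andP[bu uc]; rewrite muleA; congr (_ * _).
by rewrite muleC -(running_sum_seq w f0 uc).
Qed.

Lemma compensator_sqr f w : (forall x, 0 <= f x) -> predictable f ->
  comp f w * comp f w = 2%:E * comp (f \* running_integral b (f \* lam)) w.
Proof.
move=> f0 mf.
rewrite /compensator (@integral_sqr_ordered _ b c (fun t => (f \* lam) (t, w)))//.
- congr (_ * _); apply: eq_integral => u _; rewrite /running_integral/=.
  by rewrite muleA; congr (_ * _); rewrite muleC.
- apply: measurable_funTS; apply: emeasurable_funM; apply: predictable_path => //.
  exact: predictable_intensity.
- by move=> t; rewrite mule_ge0.
Qed.

End campbell.

(** * The isometry for weights with bounded sums *)

Lemma seq_max_exists (R : realDomainType) (s : seq R) : s != [::] ->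
  exists2 m, m \in s & forall x, x \in s -> x <= m.
Proof.
elim: s => // x s ih _; have [->|/ih [m ms mmax]] := eqVneq s [::].
  by exists x; rewrite ?mem_head// => y; rewrite inE => /eqP ->.
have [xm|mx] := leP x m.
  exists m; first by rewrite inE ms orbT.
  by move=> y; rewrite inE => /orP[/eqP ->//|/mmax].
exists x; first exact: mem_head.
move=> y; rewrite inE => /orP[/eqP ->//|/mmax ym].
by rewrite (le_trans ym)// ltW.
Qed.

(** Remove the largest element m among those with at most n predecessors: the
    others are predecessors of m, hence at most n. *)
Lemma count_low_rank (R : realDomainType) (s : seq R) (n : nat) : uniq s ->
  (count (fun t => (count (fun r => (r < t)%R) s <= n)%N) s <= n.+1)%N.
Proof.
move=> us; rewrite -size_filter; set L := seq.filter _ s.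
have [->//|/seq_max_exists[m]] := eqVneq L [::].
rewrite mem_filter => /andP[mn ms] mmax.
have uL : uniq L by exact: filter_uniq.
have mL : m \in L by rewrite mem_filter mn.
rewrite (perm_size (perm_to_rem mL))/= ltnS (leq_trans _ mn)//.
rewrite -size_filter; apply: uniq_leq_size; first exact: rem_uniq.
move=> x; rewrite mem_rem_uniq// inE => /andP[/eqP xm xL].
rewrite mem_filter; have := xL; rewrite mem_filter => /andP[_ ->]; rewrite andbT.
by rewrite lt_neqAle mmax// andbT; apply/eqP.
Qed.

(** With JJ, JC, CC the means of J^2, J C, C^2 and I that of (J - C)^2, the
    running terms x and y cancel.  The finiteness of JJ and JC forces that of
    x, y and z, hence of CC. *)
Lemma second_moment_cancel (R : realType) (I JJ JC CC x y z : \bar R) :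
  (0 <= z -> 0 <= x -> 0 <= y ->
  JJ = z + 2%:E * x -> JC = y + x -> CC = 2%:E * y ->
  JJ < +oo -> JC < +oo -> I + 2%:E * JC = JJ + CC -> I = z)%E.
Proof.
case: z => [z| |]//; case: x => [x| |]//; case: y => [y| |]//; rewrite ?lee_fin;
  move=> z0 x0 y0 -> -> ->; rewrite -?EFinM -?EFinD -?EFinM//.
by case: I => [I| |]//= _ _ [h]; congr (_%:E); lra.
Qed.

Section isometry.
Local Open Scope ereal_scope.
Context (R : realType) (d : measure_display) (Omega : measurableType d)
  (P : probability Omega R) (N : Omega -> set R) (s0 : \bar R)
  (lam : R * Omega -> \bar R)
  (sN : simple_point_process N)
  (hI : has_stochastic_intensity P N s0 lam)
  (b c : R) (s0b : s0 <= b%:E) (bc : (b <= c)%R).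
Local Notation predictableT := (predictableT N s0).
Local Notation predictable f := (measurable_fun [set: predictableT] (f : predictableT -> \bar R)).
Local Notation jump := (jump_sum N b c).
Local Notation comp := (compensator lam b c).
Local Notation EE := (mean_intensity P lam b c).
Implicit Types f g : R * Omega -> \bar R.

(** The integral of f against N(dt) - lam dt over ]b, c]; outside a null set
    both terms are finite for the weights considered here. *)
Definition compensated f w : R :=
  (fine (jump_sum N b c f w) - fine (compensator lam b c f w))%R.
Local Notation M := compensated.

Let lam0 x : 0 <= lam x. Proof. by have [] := hI. Qed.
Let plam := predictable_intensity hI.

Lemma measurable_compensated f : (forall x, 0 <= f x) -> predictable f ->
  measurable_fun [set: Omega] (M f).
Proof.
move=> f0 mf; apply: measurable_funB.
  apply: measurableT_comp => //; exact: (measurable_jump_sum sN s0b bc f0 mf).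
apply: measurableT_comp => //; exact: (measurable_compensator sN hI s0b bc f0 mf).
Qed.

Lemma compensator_fin_ae f : (forall x, 0 <= f x) -> predictable f ->
  EE f < +oo -> {ae P, forall w, comp f w \is a fin_num}.
Proof.
move=> f0 mf Ef.
have mc := measurable_compensator sN hI s0b bc f0 mf.
have ic : P.-integrable [set: Omega] (comp f).
  apply/integrableP; split => //.
  rewrite (_ : \int[P]_w `|comp f w| = EE f)//.
  by apply: eq_integral => w _; rewrite gee0_abs// (compensator_ge0 hI).
by apply: filterS (integrable_ae measurableT ic) => w; exact.
Qed.

Lemma running_sum_ge0 f x : (forall x, 0 <= f x) -> 0 <= running_sum N b f x.
Proof. by move=> f0; apply: esum_ge0. Qed.

Lemma running_integral_ge0 f x : (forall x, 0 <= f x) ->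
  0 <= running_integral b f x.
Proof. by move=> f0; apply: integral_ge0. Qed.

(** The bound K on the sum over the points makes the means of J^2 and J C
    finite, so that the running terms can be cancelled. *)
Lemma isometry_of_bounded_jumps f (K : R) :
  (forall x, 0 <= f x) -> predictable f ->
  (forall w, jump f w <= K%:E) -> EE f < +oo ->
  \int[P]_w ((M f w) ^+ 2)%:E = EE (f \* f).
Proof.
move=> f0 mf JK Ef.
have fl0 x : 0 <= (f \* lam) x by rewrite mule_ge0.
have mfl : predictable (f \* lam) by exact: emeasurable_funM.
have mrs : predictable (running_sum N b f) by exact: measurable_running_sum.
have mri : predictable (running_integral b (f \* lam)).
  exact: measurable_running_integral.
pose fA := f \* running_sum N b f.
pose fL := f \* running_integral b (f \* lam).
have fA0 x : 0 <= fA x by rewrite mule_ge0// running_sum_ge0.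
have fL0 x : 0 <= fL x by rewrite mule_ge0// running_integral_ge0.
have ff0 x : 0 <= (f \* f) x by rewrite mule_ge0.
have mfA : predictable fA by exact: emeasurable_funM.
have mfL : predictable fL by exact: emeasurable_funM.
have mff : predictable (f \* f) by exact: emeasurable_funM.
have mJ := measurable_jump_sum sN s0b bc.
have mC := measurable_compensator sN hI s0b bc.
have J0 g w : (forall x, 0 <= g x) -> 0 <= jump g w by exact: jump_sum_ge0.
have C0 g w : (forall x, 0 <= g x) -> 0 <= comp g w by exact: (compensator_ge0 hI).
have E0 g : (forall x, 0 <= g x) -> 0 <= EE g by exact: (mean_intensity_ge0 hI).
have camp := jump_sum_campbell hI s0b bc.
have EJJ : \int[P]_w (jump f w * jump f w) = EE (f \* f) + 2%:E * EE fA.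
  rewrite -!camp// -ge0_integralZl//; [|exact: mJ|by move=> *; exact: J0].
  rewrite -ge0_integralD//; first last.
  - by apply: measurable_funeM; exact: mJ.
  - by move=> w _; rewrite mule_ge0// J0.
  - exact: mJ.
  - by move=> w _; exact: J0.
  by apply: eq_integral => w _; rewrite jump_sum_sqr.
have EJC : \int[P]_w (jump f w * comp f w) = EE fL + EE fA.
  rewrite -(camp fL)// -ge0_integralD//; first last.
  - exact: mC.
  - by move=> w _; exact: C0.
  - exact: mJ.
  - by move=> w _; exact: J0.
  by apply: eq_integral => w _; rewrite (jump_sum_compensator sN hI).
have ECC : \int[P]_w (comp f w * comp f w) = 2%:E * EE fL.
  rewrite -ge0_integralZl//; [|exact: mC|by move=> *; exact: C0].
  by apply: eq_integral => w _; rewrite (compensator_sqr sN hI).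
have K0 (w : Omega) : (0 <= K)%R by rewrite -lee_fin (le_trans _ (JK w))// J0.
have Jfin w : jump f w \is a fin_num.
  by rewrite ge0_fin_numE ?J0// (le_lt_trans (JK w))// ltry.
have EJJfin : \int[P]_w (jump f w * jump f w) < +oo.
  apply: (@le_lt_trans _ _ (\int[P]_w (cst (K * K)%:E w))).
    apply: ge0_le_integral_set => w _; first by rewrite mule_ge0// J0.
    by rewrite EFinM lee_pmul// J0.
  rewrite integral_cst// [X in _ * X](_ : _ = 1) ?mule1 ?ltry//.
  exact: probability_setT.
have EJCfin : \int[P]_w (jump f w * comp f w) < +oo.
  apply: (@le_lt_trans _ _ (`|K|%:E * EE f)).
    rewrite /mean_intensity -ge0_integralZl//.
    - apply: ge0_le_integral_set => w _; first by rewrite mule_ge0 ?J0 ?C0.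
      rewrite ger0_norm ?(K0 w)// lee_wpmul2r ?C0//.
    - exact: mC.
    - by move=> w _; exact: C0.
  by rewrite lte_mul_pinfty// lee_fin.
have mM : measurable_fun [set: Omega] (M f) by exact: measurable_compensated.
apply: (second_moment_cancel (E0 _ ff0) (E0 _ fA0) (E0 _ fL0) EJJ EJC ECC
  EJJfin EJCfin).
have mJJ : measurable_fun [set: Omega] (fun w => jump f w * jump f w).
  by apply: emeasurable_funM; exact: mJ.
have mCC : measurable_fun [set: Omega] (fun w => comp f w * comp f w).
  by apply: emeasurable_funM; exact: mC.
have mJC : measurable_fun [set: Omega] (fun w => jump f w * comp f w).
  by apply: emeasurable_funM; [exact: mJ|exact: mC].
have mMM : measurable_fun [set: Omega] (fun w => ((M f w) ^+ 2)%:E).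
  by apply/measurable_EFinP; exact: measurable_funX.
have JJ0 w : 0 <= jump f w * jump f w by rewrite mule_ge0 ?J0.
have CC0 w : 0 <= comp f w * comp f w by rewrite mule_ge0 ?C0.
have JC0 w : 0 <= jump f w * comp f w by rewrite mule_ge0 ?J0 ?C0.
have MM0 w : 0 <= ((M f w) ^+ 2)%:E by rewrite lee_fin sqr_ge0.
rewrite -ge0_integralZl// -!ge0_integralD//; first last.
- exact: measurable_funeM.
- by move=> w _; rewrite mule_ge0.
apply: eq_integral_ae; apply: filterS (compensator_fin_ae f0 mf Ef) => w Cfin.
rewrite /M -(fineK (Jfin w)) -(fineK Cfin) -!EFinM -!EFinD /=.
by congr (_%:E); ring.
Qed.

End isometry.

(** * Cutting a weight after the first points of the window *)

Section localization.
Local Open Scope ereal_scope.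
Context (R : realType) (d : measure_display) (Omega : measurableType d)
  (P : probability Omega R) (N : Omega -> set R) (s0 : \bar R)
  (lam : R * Omega -> \bar R)
  (sN : simple_point_process N)
  (hI : has_stochastic_intensity P N s0 lam)
  (b c : R) (s0b : s0 <= b%:E) (bc : (b <= c)%R).
Local Notation predictableT := (predictableT N s0).
Local Notation predictable f := (measurable_fun [set: predictableT] (f : predictableT -> \bar R)).
Local Notation jump := (jump_sum N b c).
Local Notation comp := (compensator lam b c).
Local Notation EE := (mean_intensity P lam b c).
Local Notation M := (compensated N lam b c).
Implicit Types f g : R * Omega -> \bar R.

(** A cut by the number of earlier points bounds the sum of a cut weight over
    the points; it depends on the strict past alone, hence is predictable. *)
Definition early (n : nat) (x : R * Omega) : bool :=
  running_sum N b (cst 1) x <= n%:R%:E.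

Lemma measurable_early n : measurable_fun [set: predictableT] (early n : predictableT -> bool).
Proof.
have mr : predictable (running_sum N b (cst 1)).
  by apply: measurable_running_sum => //; exact: measurable_cst.
have := measurable_lee measurableT mr (measurable_cst n%:R%:E).
by move=> me; apply: (@measurable_fun_bool _ _ setT _ true).
Qed.

Lemma early_indicator n : predictable (fun x => (early n x)%:R%:E).
Proof. by apply: measurable_fun_indicator => //; exact: measurable_early. Qed.

Lemma late_indicator n : predictable (fun x => (~~ early n x)%:R%:E).
Proof.
apply: measurable_fun_indicator => //.
by apply: measurableT_comp => //; exact: measurable_early.
Qed.

Lemma sume_indicator (T : Type) (s : seq T) (p : pred T) :
  \sum_(x <- s) (p x)%:R%:E = (count p s)%:R%:E :> \bar R.
Proof.
rewrite sumEFin -natr_sum -sum1_count [in RHS]big_mkcond/=.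
by congr (_%:R%:E); apply: eq_bigr => x _; case: (p x).
Qed.

Lemma earlyE n w t : (t <= c)%R ->
  early n (t, w) = (count (fun r => (r < t)%R)
    (fset_set (N w `&` `]b, c])) <= n)%N.
Proof.
move=> tc; rewrite /early (running_sum_seq sN b w _ tc)//.
rewrite big_mkcond/=.
rewrite (eq_bigr (fun r => ((r < t)%R)%:R%:E)); last first.
  by move=> r _; case: ifPn.
by rewrite sume_indicator lee_fin ler_nat.
Qed.

(** The point of rank n + 1 still has only n predecessors, hence n.+1. *)
Lemma jump_sum_early n w : jump (fun x => (early n x)%:R%:E) w <= n.+1%:R%:E.
Proof.
rewrite (jump_sum_seq sN)//.
have fw := finite_windowc sN w b c.
rewrite sume_indicator lee_fin ler_nat.
apply: leq_trans (count_low_rank n (fset_uniq (fset_set (N w `&` `]b, c])))).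
apply/eq_leq/eq_in_count => t /(mem_fset_set _ fw) [_ /=].
by rewrite in_itv/= => /andP[_ /earlyE].
Qed.

Lemma early_eventually w : exists n0, forall n, (n0 <= n)%N ->
  forall t, (t <= c)%R -> early n (t, w).
Proof.
exists (size (fset_set (N w `&` `]b, c]))) => n n0n t tc.
by rewrite earlyE// (leq_trans (count_size _ _)).
Qed.

(** Cutting in time rather than in size keeps f = truncated + remainder with
    the two parts supported on disjoint sets, hence also f^2 = truncated^2 +
    remainder^2. *)
Definition truncated f n x : \bar R := (early n x)%:R%:E * f x.
Definition remainder f n x : \bar R := (~~ early n x)%:R%:E * f x.

Lemma truncated_ge0 f n : (forall x, 0 <= f x) -> forall x, 0 <= truncated f n x.
Proof. by move=> f0 x; rewrite mule_ge0// lee_fin. Qed.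

Lemma remainder_ge0 f n : (forall x, 0 <= f x) -> forall x, 0 <= remainder f n x.
Proof. by move=> f0 x; rewrite mule_ge0// lee_fin. Qed.

Lemma predictable_truncated f n : predictable f -> predictable (truncated f n).
Proof. by move=> mf; apply: emeasurable_funM => //; exact: early_indicator. Qed.

Lemma predictable_remainder f n : predictable f -> predictable (remainder f n).
Proof. by move=> mf; apply: emeasurable_funM => //; exact: late_indicator. Qed.

Lemma truncated_split f n x : f x = truncated f n x + remainder f n x.
Proof.
by rewrite /truncated /remainder; case: early; rewrite /= !(mul1e, mul0e, add0e, adde0).
Qed.

Lemma truncated_sqr_split f n x :
  f x * f x = truncated f n x * truncated f n x +
              remainder f n x * remainder f n x.
Proof.
by rewrite /truncated /remainder; case: early; rewrite /= !(mul1e, mul0e, add0e, adde0).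
Qed.

Lemma truncated_eventually f w : exists n0, forall n, (n0 <= n)%N ->
  forall t, (t <= c)%R -> truncated f n (t, w) = f (t, w).
Proof.
have [n0 h] := early_eventually w; exists n0 => n /h en t /en.
by rewrite /truncated => ->; rewrite mul1e.
Qed.

Lemma eq_on_window f g w : (forall t, (t <= c)%R -> f (t, w) = g (t, w)) ->
  jump f w = jump g w /\ comp f w = comp g w.
Proof.
move=> fg; split.
  by apply: eq_esum => t [_ /=]; rewrite in_itv/= => /andP[_ /fg].
apply: eq_integral => t /set_mem /=; rewrite in_itv/= => /andP[_ tc].
by rewrite fg.
Qed.

(** Each path has finitely many points in the window, so it is not affected by
    the cut once n exceeds their number. *)
Lemma compensated_truncated_eventually f w : exists n0, forall n, (n0 <= n)%N ->
  M (truncated f n) w = M f w.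
Proof.
have [n0 h] := truncated_eventually f w; exists n0 => n /h en.
by rewrite /compensated; have [-> ->] := eq_on_window en.
Qed.

Context (f : R * Omega -> \bar R) (C : R) (f0 : forall x, 0 <= f x)
  (fC : forall x, f x <= C%:E) (mf : predictable f) (Ef : EE f < +oo).

Lemma isometry_truncated n :
  \int[P]_w ((M (truncated f n) w) ^+ 2)%:E = EE (truncated f n \* truncated f n).
Proof.
have C0 : (0 <= C)%R by rewrite -lee_fin (le_trans (f0 (0%R, point))).
apply: (isometry_of_bounded_jumps sN hI s0b bc (K := (C * n.+1%:R)%R)).
- exact: truncated_ge0.
- exact: predictable_truncated.
- move=> w; apply: (@le_trans _ _ (C%:E * jump (fun x => (early n x)%:R%:E) w)).
    rewrite !(jump_sum_seq sN)//; last exact: truncated_ge0.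
    rewrite ge0_sume_distrr; last by move=> x _; rewrite lee_fin.
    apply: lee_sum => t _; rewrite /truncated muleC.
    by apply: lee_wpmul2r; rewrite ?lee_fin.
  by rewrite EFinM; apply: lee_wpmul2l; rewrite ?lee_fin//; exact: jump_sum_early.
- apply: le_lt_trans Ef; apply: (le_mean_intensity hI).
    exact: truncated_ge0.
  move=> x; rewrite [leRHS](truncated_split f n).
  by rewrite leeDl// remainder_ge0.
Qed.

Lemma mean_intensity_sqr_fin : EE (f \* f) < +oo.
Proof.
have C0 : (0 <= C)%R by rewrite -lee_fin (le_trans (f0 (0%R, point))).
apply: (@le_lt_trans _ _ (EE (fun x => C%:E * f x))).
  apply: (le_mean_intensity hI) => x; first by rewrite mule_ge0.
  exact: lee_wpmul2r.
by rewrite (mean_intensityZ sN hI)// lte_mul_pinfty// lee_fin.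
Qed.

(** Fatou applied to the truncations, which satisfy the isometry. *)
Lemma isometry_le : \int[P]_w ((M f w) ^+ 2)%:E <= EE (f \* f).
Proof.
pose h n w := ((M (truncated f n) w) ^+ 2)%:E.
have mh n : measurable_fun [set: Omega] (h n).
  apply/measurable_EFinP; apply: measurable_funX.
  apply: (measurable_compensated sN hI s0b bc).
    exact: truncated_ge0.
  exact: predictable_truncated.
have h0 n w : 0 <= h n w by rewrite lee_fin sqr_ge0.
have hE w : limn_einf (h ^~ w) = ((M f w) ^+ 2)%:E.
  have [n0 hn0] := compensated_truncated_eventually f w.
  have cv : h ^~ w @ \oo --> ((M f w) ^+ 2)%:E.
    apply: cvg_near_cst; near=> n; rewrite /h hn0//.
    by near: n; exact: nbhs_infty_ge.
  rewrite is_cvg_limn_einfE; first exact/cvg_lim.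
  by apply/cvg_ex; exists ((M f w) ^+ 2)%:E.
under eq_integral do rewrite -hE.
apply: (le_trans (fatou P measurableT mh (fun n w _ => h0 n w))).
rewrite limn_einf_lim; apply: lime_le; first exact: is_cvg_einfs.
apply: nearW => n; apply: (@le_trans _ _ (\int[P]_w h n w)).
  by apply: ereal_inf_lbound; exists n => //=.
rewrite /h isometry_truncated.
apply: (le_mean_intensity hI) => x; first by rewrite mule_ge0// truncated_ge0.
rewrite /= [leRHS](truncated_sqr_split f n) leeDl// mule_ge0// remainder_ge0//.
Unshelve. all: by end_near.
Qed.

End localization.

(** * The isometry for bounded weights *)

(** First choose e so small that e X is negligible, then n for which the factor
    of r n does not matter. *)
Lemma le_of_weighted (R : realFieldType) (X z : R) (r : nat -> R) :
  0 <= X -> (forall e, 0 < e -> exists n, r n <= e) ->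
  (forall e n, 0 < e -> z <= (1 + e) * X + (2 + e^-1) * r n) -> z <= X.
Proof.
move=> X0 r0 zX; apply/ler_addgt0Pr => e e0.
(* k X <= e / 2, and X + 1 avoids a division by zero *)
pose k := e / (2 * (X + 1)).
have k0 : 0 < k by rewrite divr_gt0// mulr_gt0// ltr_wpDl.
pose q := 2 + k^-1.
have q0 : 0 < q by rewrite ltr_pwDl// invr_ge0 ltW.
have [n rn] := r0 (e / (2 * q)) (divr_gt0 e0 (mulr_gt0 (ltr0Sn R 1) q0)).
apply: le_trans (zX k n k0) _; rewrite -/q.
have kX : k * X <= e / 2.
  rewrite /k mulrAC ler_pdivrMr ?mulr_gt0 ?ltr_wpDl//.
  by rewrite mulrA divfK// ler_pM2l// lerDl.
have qr : q * r n <= e / 2.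
  rewrite (le_trans (ler_wpM2l (ltW q0) rn))//.
  by rewrite (_ : q * (e / (2 * q)) = e / 2)//; field; rewrite gt_eqF.
by rewrite mulrDl mul1r; lra.
Qed.

Section isometry_general.
Local Open Scope ereal_scope.
Context (R : realType) (d : measure_display) (Omega : measurableType d)
  (P : probability Omega R) (N : Omega -> set R) (s0 : \bar R)
  (lam : R * Omega -> \bar R)
  (sN : simple_point_process N)
  (hI : has_stochastic_intensity P N s0 lam)
  (b c : R) (s0b : s0 <= b%:E) (bc : (b <= c)%R).
Local Notation predictableT := (predictableT N s0).
Local Notation predictable f := (measurable_fun [set: predictableT] (f : predictableT -> \bar R)).
Local Notation jump := (jump_sum N b c).
Local Notation comp := (compensator lam b c).
Local Notation EE := (mean_intensity P lam b c).
Local Notation M := (compensated N lam b c).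
Local Notation truncated := (truncated N b).
Local Notation remainder := (remainder N b).
Implicit Types f g : R * Omega -> \bar R.

Lemma jump_sum_fin f w : (forall x, 0 <= f x) -> (forall x, f x < +oo) ->
  jump f w \is a fin_num.
Proof.
move=> f0 fy; rewrite (jump_sum_seq sN)//; apply/sum_fin_numP => t _ _.
by rewrite ge0_fin_numE.
Qed.

Lemma compensatedD_ae f g : (forall x, 0 <= f x) -> (forall x, 0 <= g x) ->
  (forall x, f x < +oo) -> (forall x, g x < +oo) ->
  predictable f -> predictable g -> EE f < +oo -> EE g < +oo ->
  {ae P, forall w, M (f \+ g) w = (M f w + M g w)%R}.
Proof.
move=> f0 g0 fy gy mf mg Ef Eg.
have := compensator_fin_ae sN hI s0b bc f0 mf Ef.
have := compensator_fin_ae sN hI s0b bc g0 mg Eg.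
apply: filterS2 => w cg cf; rewrite /compensated.
rewrite jump_sumD// (compensatorD sN hI)// fineD ?jump_sum_fin// fineD//.
by ring.
Qed.

Section bounded_integrand.
Context (f : R * Omega -> \bar R) (C : R) (f0 : forall x, 0 <= f x)
  (fC : forall x, f x <= C%:E) (mf : predictable f) (Ef : EE f < +oo).

Let mT n := predictable_truncated sN s0b n mf.
Let mRm n := predictable_remainder sN s0b n mf.
Let T0 n := truncated_ge0 N b n f0.
Let Rm0 n := remainder_ge0 N b n f0.

Let le_truncated n x : truncated f n x <= f x.
Proof. by rewrite [leRHS](truncated_split N b f n) leeDl. Qed.

Let le_remainder n x : remainder f n x <= f x.
Proof. by rewrite [leRHS](truncated_split N b f n) leeDr. Qed.

Let mTT n : predictable (truncated f n \* truncated f n).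
Proof. exact: emeasurable_funM. Qed.

Let mRR n : predictable (remainder f n \* remainder f n).
Proof. exact: emeasurable_funM. Qed.

(** By the Campbell formula the mean is that of a sum over finitely many
    points, to which monotone convergence applies; each such sum is eventually
    constant in n. *)
Lemma cvg_mean_truncated_sqr :
  EE (truncated f n \* truncated f n) @[n --> \oo] --> EE (f \* f).
Proof.
have TT0 n x : 0 <= (truncated f n \* truncated f n) x by rewrite mule_ge0// T0.
have ff0 x : 0 <= (f \* f) x by rewrite mule_ge0.
have mff : predictable (f \* f) by exact: emeasurable_funM.
have camp := jump_sum_campbell hI s0b bc.
rewrite -(camp (f \* f))//.
under eq_fun do rewrite -camp//.
have nd w n m : (n <= m)%N ->
    jump (truncated f n \* truncated f n) w <= jump (truncated f m \* truncated f m) w.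
  move=> nm; apply: le_esum => t _ /=.
  have Tnm : truncated f n (t, w) <= truncated f m (t, w).
    rewrite /truncated /early lee_wpmul2r// lee_fin ler_nat.
    case: (leP _ n%:R%:E) => [h|_]; last by case: (_ <= _).
    by rewrite (le_trans h)// lee_fin ler_nat.
  by apply: lee_pmul => //; exact: T0.
have cv w : jump (truncated f n \* truncated f n) w @[n --> \oo] --> jump (f \* f) w.
  have [n0 hn0] := truncated_eventually sN b c f w.
  apply: cvg_near_cst; near=> n.
  have n0n : (n0 <= n)%N by near: n; exact: nbhs_infty_ge.
  apply: (proj1 (@eq_on_window _ _ _ N lam b c
    (truncated f n \* truncated f n) (f \* f) w _)).
  by move=> t tc /=; rewrite hn0.
rewrite (_ : \int[P]_w jump (f \* f) w =
  \int[P]_w limn (fun n => jump (truncated f n \* truncated f n) w)); last first.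
  by apply: eq_integral => w _; apply/esym/cvg_lim.
apply: cvg_monotone_convergence => //.
- by move=> n; exact: (measurable_jump_sum sN s0b bc).
- by move=> n w _; exact: jump_sum_ge0.
- by move=> w _ n m nm; exact: nd.
Unshelve. all: by end_near.
Qed.

(** The reverse of [isometry_le].  With r the compensated integral of the
    remainder and m that of f, (m - r)^2 <= (1 + e) m^2 + (1 + 1 / e) r^2, and the
    mean of r^2 is at most that of the integral of remainder^2 lam, which tends
    to 0. *)
Lemma compensated_isometry : \int[P]_w ((M f w) ^+ 2)%:E = EE (f \* f).
Proof.
have fy x : f x < +oo by rewrite (le_lt_trans (fC x))// ltry.
apply/eqP; rewrite eq_le (isometry_le sN hI s0b bc f0 fC mf Ef)/=.
set X := \int[P]_w _.
have X0 : 0 <= X by apply: integral_ge0 => w _; rewrite lee_fin sqr_ge0.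
have zfin : EE (f \* f) \is a fin_num.
  rewrite ge0_fin_numE; first exact: (mean_intensity_sqr_fin sN hI s0b bc f0 fC mf Ef).
  by apply: (mean_intensity_ge0 hI) => x; rewrite mule_ge0.
have Xfin : X \is a fin_num.
  rewrite ge0_fin_numE//; apply: le_lt_trans (isometry_le sN hI s0b bc f0 fC mf Ef) _.
  by rewrite -ge0_fin_numE// (le_trans X0)// (isometry_le sN hI s0b bc f0 fC mf Ef).
(* atoms for the real arithmetic that follows *)
have [tn tnE] : exists tn : nat -> \bar R,
  forall n, EE (truncated f n \* truncated f n) = tn n by eexists.
have [rn rnE] : exists rn : nat -> \bar R,
  forall n, EE (remainder f n \* remainder f n) = rn n by eexists.
have [z zE] : exists z : \bar R, EE (f \* f) = z by eexists.
have tn0 n : 0 <= tn n.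
  by rewrite -tnE; apply: (mean_intensity_ge0 hI) => x; rewrite mule_ge0// T0.
have rn0 n : 0 <= rn n.
  by rewrite -rnE; apply: (mean_intensity_ge0 hI) => x; rewrite mule_ge0// Rm0.
have trz n : z = tn n + rn n.
  have TT0 x : 0 <= (truncated f n \* truncated f n) x by rewrite mule_ge0// T0.
  have RR0 x : 0 <= (remainder f n \* remainder f n) x by rewrite mule_ge0// Rm0.
  rewrite -zE -tnE -rnE.
  apply: etrans (mean_intensityD sN hI s0b bc TT0 RR0 (mTT n) (mRR n)).
  by congr (mean_intensity _ _ _ _ _); apply/funext => x; exact: truncated_sqr_split.
rewrite zE in zfin *.
have tnfin n : tn n \is a fin_num.
  by move: zfin; rewrite (trz n) fin_numD => /andP[].
have rnfin n : rn n \is a fin_num.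
  by move: zfin; rewrite (trz n) fin_numD => /andP[].
rewrite -(fineK zfin) -(fineK Xfin) lee_fin.
apply: (le_of_weighted (r := fun n => fine (rn n))).
- exact: fine_ge0.
- move=> e e0.
  have := cvg_mean_truncated_sqr; rewrite zE -(fineK zfin).
  under eq_fun do rewrite tnE.
  move=> /fine_cvgP[_].
  move=> /cvgrPdist_le /(_ e e0) [n _ /(_ n (leqnn n))] /= h; exists n.
  apply: le_trans h; rewrite (trz n) fineD//.
  by rewrite addrAC subrr add0r ler_norm.
- move=> e n e0.
  suff : (fine (tn n) <= (1 + e) * fine X + (1 + e^-1) * fine (rn n))%R.
    have -> : fine z = (fine (tn n) + fine (rn n))%R.
      by rewrite (trz n) fineD.
    by move=> h; rewrite -subr_ge0; move: h; rewrite -subr_ge0; congr (0 <= _)%R; ring.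
  have mM := measurable_compensated sN hI s0b bc.
  have mMf : measurable_fun [set: Omega] (fun w => ((M f w) ^+ 2)%:E).
    by apply/measurable_EFinP; apply: measurable_funX; exact: mM.
  have mMR : measurable_fun [set: Omega] (fun w => ((M (remainder f n) w) ^+ 2)%:E).
    by apply/measurable_EFinP; apply: measurable_funX; exact: mM.
  have mMT : measurable_fun [set: Omega] (fun w => ((M (truncated f n) w) ^+ 2)%:E).
    by apply/measurable_EFinP; apply: measurable_funX; exact: mM.
  have sq0 (h : Omega -> R) w : 0 <= ((h w) ^+ 2)%:E by rewrite lee_fin sqr_ge0.
  have e1 : (0 <= 1 + e)%R by rewrite addr_ge0// ltW.
  have e1' : (0 <= 1 + e^-1)%R by rewrite addr_ge0// invr_ge0 ltW.
  have ERfin : EE (remainder f n) < +oo.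
    by apply: le_lt_trans Ef; exact: (le_mean_intensity hI).
  have ETfin : EE (truncated f n) < +oo.
    by apply: le_lt_trans Ef; exact: (le_mean_intensity hI).
  rewrite -lee_fin EFinD !EFinM !fineK//.
  rewrite -tnE -(isometry_truncated sN hI s0b bc f0 fC mf Ef n).
  have RX : \int[P]_w ((M (remainder f n) w) ^+ 2)%:E <= rn n.
    rewrite -rnE; apply: (isometry_le sN hI s0b bc (C := C)) => // x.
    exact: le_trans (le_remainder n x) (fC x).
  apply: (@le_trans _ _ ((1 + e)%:E * X +
      (1 + e^-1)%:E * \int[P]_w ((M (remainder f n) w) ^+ 2)%:E)); last first.
    by apply: leeD => //; apply: lee_wpmul2l => //; rewrite lee_fin.
  have scale (k : R) (h : Omega -> R) : (0 <= k)%R ->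
      measurable_fun [set: Omega] (fun w => ((h w) ^+ 2)%:E) ->
      k%:E * \int[P]_w ((h w) ^+ 2)%:E = \int[P]_w (k%:E * ((h w) ^+ 2)%:E).
    by move=> k0 mh; rewrite ge0_integralZl.
  rewrite (scale _ (M f))// (scale _ (M (remainder f n)))//.
  rewrite -ge0_integralD//; first last.
  - exact: measurable_funeM.
  - by move=> w _; rewrite mule_ge0// lee_fin.
  - exact: measurable_funeM.
  - by move=> w _; rewrite mule_ge0// lee_fin.
  apply: ae_ge0_le_integral => //.
  - by move=> w _; rewrite adde_ge0// mule_ge0// lee_fin.
  - by apply: emeasurable_funD; exact: measurable_funeM.
  have Ty x : truncated f n x < +oo by rewrite (le_lt_trans (le_truncated n x)).
  have Ry x : remainder f n x < +oo by rewrite (le_lt_trans (le_remainder n x)).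
  have := compensatedD_ae (T0 n) (Rm0 n) Ty Ry (mT n) (mRm n) ETfin ERfin.
  apply: filterS => w; rewrite [X in M X](_ : _ = f); last first.
    by apply/funext => x; rewrite [RHS](truncated_split N b f n).
  move=> -> _; rewrite -!EFinM -EFinD lee_fin.
  (* here m is the value on the truncation: (1 + e) (m + r)^2 +
     (1 + 1 / e) r^2 - m^2 is a square up to the factor 1 / e *)
  set m := M _ w; set r := M _ w.
  rewrite -subr_ge0 [X in (0 <= X)%R](_ : _ = e^-1 * (e * (m + r) + r) ^+ 2)%R.
    by rewrite mulr_ge0// ?sqr_ge0// invr_ge0 ltW.
  by field; rewrite gt_eqF.
Qed.

Lemma integrable_compensated_sqr :
  P.-integrable [set: Omega] (fun w => ((M f w) ^+ 2)%:E).
Proof.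
apply/integrableP; split.
  apply/measurable_EFinP; apply: measurable_funX.
  exact: (measurable_compensated sN hI s0b bc).
under eq_integral do rewrite gee0_abs ?lee_fin ?sqr_ge0//.
rewrite compensated_isometry.
exact: (mean_intensity_sqr_fin sN hI s0b bc f0 fC mf Ef).
Qed.

Lemma integrable_compensated : P.-integrable [set: Omega] (EFin \o M f).
Proof.
apply: (@le_integrable _ _ _ P _ measurableT _
  (fun w => (1 + (M f w) ^+ 2)%:E)).
- apply/measurable_EFinP; exact: (measurable_compensated sN hI s0b bc).
- move=> w _; rewrite /= lee_fin ler_norml.
  rewrite (ger0_norm (x := (1 + _)%R)); last by rewrite addr_ge0// sqr_ge0.
  apply/andP; split; nra.
- under eq_fun do rewrite EFinD.
  apply: integrableD => //; last exact: integrable_compensated_sqr.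
  exact: finite_measure_integrable_cst.
Qed.

Lemma compensated_mean0 : \int[P]_w (M f w)%:E = 0.
Proof.
have fy x : f x < +oo by rewrite (le_lt_trans (fC x))// ltry.
have mJ := measurable_jump_sum sN s0b bc f0 mf.
have mC := measurable_compensator sN hI s0b bc f0 mf.
have EJ : \int[P]_w jump f w = EE f := jump_sum_campbell hI s0b bc f0 mf.
have iJ : P.-integrable [set: Omega] (jump f).
  apply/integrableP; split => //.
  under eq_integral do rewrite gee0_abs ?jump_sum_ge0//.
  by rewrite EJ.
have iC : P.-integrable [set: Omega] (comp f).
  apply/integrableP; split => //.
  under eq_integral do rewrite gee0_abs ?(compensator_ge0 hI)//.
  exact: Ef.
rewrite (eq_integral_ae (g := fun w => jump f w - comp f w)).
  rewrite integralB// EJ subee//.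
  by rewrite ge0_fin_numE// (mean_intensity_ge0 hI).
have := compensator_fin_ae sN hI s0b bc f0 mf Ef.
by apply: filterS => w cf; rewrite /compensated EFinB !fineK ?jump_sum_fin.
Qed.

End bounded_integrand.

Lemma integrable_compensatedM f g (C : R) :
  (forall x, 0 <= f x) -> (forall x, 0 <= g x) ->
  (forall x, f x <= C%:E) -> (forall x, g x <= C%:E) ->
  predictable f -> predictable g -> EE f < +oo -> EE g < +oo ->
  P.-integrable [set: Omega] (fun w => (M f w * M g w)%:E).
Proof.
move=> f0 g0 fC gC mf mg Ef Eg.
have iff := integrable_compensated_sqr f0 fC mf Ef.
have igg := integrable_compensated_sqr g0 gC mg Eg.
have mMf := measurable_compensated sN hI s0b bc f0 mf.
have mMg := measurable_compensated sN hI s0b bc g0 mg.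
apply: (@le_integrable _ _ _ P _ measurableT _
  (fun w => ((M f w) ^+ 2 + (M g w) ^+ 2)%:E)).
- by apply/measurable_EFinP; exact: measurable_funM.
- move=> w _; rewrite /= lee_fin ler_norml.
  rewrite (ger0_norm (x := (_ + _)%R)); last by rewrite addr_ge0// sqr_ge0.
  by apply/andP; split; nra.
- by under eq_fun do rewrite EFinD; exact: integrableD.
Qed.

(** Polarisation: compare the isometry for f + g with those for f and g. *)
Lemma compensated_covariance f g (C : R) :
  (forall x, 0 <= f x) -> (forall x, 0 <= g x) ->
  (forall x, f x <= C%:E) -> (forall x, g x <= C%:E) ->
  predictable f -> predictable g -> EE f < +oo -> EE g < +oo ->
  \int[P]_w (M f w * M g w)%:E = EE (f \* g).
Proof.
move=> f0 g0 fC gC mf mg Ef Eg.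
have fy x : f x < +oo by rewrite (le_lt_trans (fC x))// ltry.
have gy x : g x < +oo by rewrite (le_lt_trans (gC x))// ltry.
pose h := f \+ g.
have h0 x : 0 <= h x by rewrite adde_ge0.
have hC x : h x <= (C + C)%:E by rewrite EFinD leeD.
have mh : predictable h by exact: emeasurable_funD.
have Eh : EE h < +oo.
  have -> : EE h = EE f + EE g by exact: (mean_intensityD sN hI s0b bc f0 g0 mf mg).
  exact: lte_add_pinfty.
have iff := integrable_compensated_sqr f0 fC mf Ef.
have igg := integrable_compensated_sqr g0 gC mg Eg.
have ihh := integrable_compensated_sqr h0 hC mh Eh.
have ifg := integrable_compensatedM f0 g0 fC gC mf mg Ef Eg.
have := compensated_isometry h0 hC mh Eh.
have -> : EE (h \* h) = EE (f \* f) + EE (g \* g) + 2%:E * EE (f \* g).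
  have ff0 x : 0 <= (f \* f) x by rewrite mule_ge0.
  have gg0 x : 0 <= (g \* g) x by rewrite mule_ge0.
  have fg0 x : 0 <= (f \* g) x by rewrite mule_ge0.
  have kfg0 x : 0 <= 2%:E * (f \* g) x by rewrite mule_ge0.
  have mff : predictable (f \* f) by exact: emeasurable_funM.
  have mgg : predictable (g \* g) by exact: emeasurable_funM.
  have mfg : predictable (f \* g) by exact: emeasurable_funM.
  have mkfg : predictable (fun x => 2%:E * (f \* g) x) by exact: measurable_funeM.
  have sum0 x : 0 <= (f \* f \+ g \* g) x by rewrite adde_ge0.
  have msum : predictable (f \* f \+ g \* g) by exact: emeasurable_funD.
  transitivity (EE ((f \* f \+ g \* g) \+ (fun x => 2%:E * (f \* g) x))).
    congr (mean_intensity _ _ _ _ _); apply/funext => x; rewrite /h/=.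
    have f_fin : f x \is a fin_num by rewrite ge0_fin_numE.
    have g_fin : g x \is a fin_num by rewrite ge0_fin_numE.
    rewrite -(fineK f_fin) -(fineK g_fin) -?EFinD -?EFinM -?EFinD.
    by congr (_%:E); ring.
  apply: etrans (mean_intensityD sN hI s0b bc sum0 kfg0 msum mkfg) _.
  congr (_ + _); first exact: (mean_intensityD sN hI s0b bc ff0 gg0 mff mgg).
  exact: (mean_intensityZ sN hI).
rewrite -(compensated_isometry f0 fC mf Ef) -(compensated_isometry g0 gC mg Eg).
have -> : \int[P]_w ((M h w) ^+ 2)%:E =
  \int[P]_w ((M f w) ^+ 2)%:E + \int[P]_w ((M g w) ^+ 2)%:E +
  2%:E * \int[P]_w (M f w * M g w)%:E.
  rewrite -integralZl// -!integralD//; first last.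
  - exact: integrableZl.
  - exact: integrableD.
  apply: eq_integral_ae.
  have := compensatedD_ae f0 g0 fy gy mf mg Ef Eg.
  apply: filterS => w; rewrite -/h => ->.
  by rewrite -!EFinM -!EFinD; congr (_%:E); ring.
have Ffin := integrable_fin_num measurableT iff.
have Gfin := integrable_fin_num measurableT igg.
have FGfin := integrable_fin_num measurableT ifg.
have EFGfin : EE (f \* g) \is a fin_num.
  rewrite ge0_fin_numE; last first.
    by apply: (mean_intensity_ge0 hI) => x; rewrite mule_ge0.
  have C0 : (0 <= C)%R by rewrite -lee_fin (le_trans (f0 (0%R, point))).
  apply: (@le_lt_trans _ _ (EE (fun x => C%:E * g x))).
    apply: (le_mean_intensity hI) => x; first by rewrite mule_ge0.
    exact: lee_wpmul2r.
  have -> : EE (fun x => C%:E * g x) = C%:E * EE g.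
    exact: (mean_intensityZ sN hI s0b bc C0 g0 mg).
  by rewrite lte_mul_pinfty// lee_fin.
have cancel (u v x y : R) :
    u%:E + v%:E + 2%:E * x%:E = u%:E + v%:E + 2%:E * y%:E -> x%:E = y%:E.
  by rewrite -!EFinM -!EFinD => -[e]; congr (_%:E); lra.
rewrite -(fineK Ffin) -(fineK Gfin) -(fineK FGfin) -(fineK EFGfin).
exact: cancel.
Qed.

End isometry_general.

(** * The mean number of points of the process started empty *)

Lemma cvge_bound (R : realType) (u : nat -> \bar R) (l K : \bar R) :
  u n @[n --> \oo] --> l -> (forall n, u n <= K)%E -> (l <= K)%E.
Proof.
move=> cv uK; rewrite -(cvg_lim _ cv)//; apply: lime_le; last exact: nearW.
by apply/cvg_ex; exists l.
Qed.

Section hawkes_mean.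
Local Open Scope ereal_scope.
Context (R : realType) (d : measure_display) (Omega : measurableType d)
  (P : probability Omega R) (N : Omega -> set R) (g : R -> R) (s0 : \bar R)
  (mu rho : R)
  (mu0 : (0 < mu)%R) (rho0 : (0 < rho)%R) (rho1 : (rho < 1)%R)
  (mg : measurable_fun (`[0%R, +oo[ : set R) g)
  (g0 : forall x, (0 <= x)%R -> (0 <= g x)%R)
  (g1 : \int[@lebesgue_measure R]_(x in `[0%R, +oo[) (g x)%:E = 1)
  (hN : hawkes_process P g s0 mu rho N).
Local Notation predictableT := (predictableT N s0).
Local Notation predictable f := (measurable_fun [set: predictableT] (f : predictableT -> \bar R)).

Definition hawkes_lambda (x : R * Omega) : \bar R :=
  hawkes_intensity g s0 mu rho (N x.2) x.1.
Local Notation lam := hawkes_lambda.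

Definition excitation (x : R * Omega) : \bar R :=
  \esum_(s in N x.2 `&` [set s | s0 < s%:E /\ (s < x.1)%R]) (g (x.1 - s)%R)%:E.

(** g extended by zero to the negative half-line and to 0, so that the
    excitation is a sum over all points; the value at 0 is dropped because a
    point does not excite its own time. *)
Definition causal_kernel (r : R) : \bar R := ((EFin \o g) \_ `]0%R, +oo[) r.
Local Notation gp := causal_kernel.

Let sN : simple_point_process N. Proof. by case: hN. Qed.
Let hI : has_stochastic_intensity P N s0 lam. Proof. by case: hN. Qed.
Let Ns0 w s : N w s -> s0 < s%:E. Proof. by case: hN => _ + _ _; exact. Qed.

Lemma hawkes_lambdaE x : lam x = mu%:E + rho%:E * excitation x.
Proof. by []. Qed.

Lemma excitation_ge0 x : 0 <= excitation x.
Proof.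
apply: esum_ge0 => s [_ [_ sx]]; rewrite lee_fin; apply: g0.
by rewrite subr_ge0 ltW.
Qed.

Lemma causal_kernel_ge0 r : 0 <= gp r.
Proof.
rewrite /causal_kernel /patch; case: ifPn => // /set_mem /=.
by rewrite in_itv/= andbT lee_fin => r0; apply: g0; exact: ltW.
Qed.

Lemma measurable_causal_kernel : measurable_fun [set: R] gp.
Proof.
apply/(measurable_restrictT _ (measurable_itv _)); apply/measurable_EFinP.
by apply: measurable_funS mg => // x /=; rewrite !in_itv/= !andbT; exact: ltW.
Qed.

Lemma integral_causal_kernel : \int[@lebesgue_measure R]_r gp r = 1.
Proof.
rewrite -g1 -integral_mkcond.
rewrite integral_itv_obnd_cbnd//; apply/measurable_EFinP.
by apply: measurable_funS mg => // x /=; rewrite !in_itv/= !andbT; exact: ltW.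
Qed.

Lemma excitationE u w : excitation (u, w) = \esum_(s in N w) gp (u - s)%R.
Proof.
rewrite /excitation /= esum_mkcondr; apply: eq_esum => s Ns.
rewrite /causal_kernel /patch /=; congr (if _ then _ else _).
apply/idP/idP => /set_mem.
  by move=> /= [_ su]; apply/mem_set; rewrite /= in_itv/= andbT subr_gt0.
rewrite /= in_itv/= andbT subr_gt0.
by move=> su; apply/mem_set; split => //; exact: Ns0 Ns.
Qed.

(** Solved from lam = mu + rho * excitation, lam being predictable by
    hypothesis. *)
Lemma predictable_excitation : predictable excitation.
Proof.
rewrite (_ : excitation = (fun x => rho^-1%:E * (lam x - mu%:E))).
  apply: measurable_funeM; apply: emeasurable_funB => //.
  exact: predictable_intensity hI.
apply/funext => x; rewrite hawkes_lambdaE addeAC subee// add0e muleA -EFinM.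
by rewrite mulVf ?gt_eqF// mul1e.
Qed.

Lemma hawkes_lambda_ge0 x : 0 <= lam x.
Proof.
rewrite hawkes_lambdaE; apply: adde_ge0; first by rewrite lee_fin ltW.
by apply: mule_ge0; [rewrite lee_fin ltW|exact: excitation_ge0].
Qed.

Section started_empty.
Context (r0 c : R) (s0r : s0 = r0%:E) (r0c : (r0 <= c)%R).
Local Notation jump := (jump_sum N r0 c).
Local Notation comp := (compensator lam r0 c).
Local Notation EE := (mean_intensity P lam r0 c).
Local Notation earlyE n := (fun x => (early N r0 n x)%:R%:E : \bar R).

Let s0r0 : s0 <= r0%:E. Proof. by rewrite s0r. Qed.

Lemma excitation_seq u w : (u <= c)%R -> excitation (u, w) =
  \sum_(s <- fset_set (N w `&` `]r0, c])) gp (u - s)%R.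
Proof.
move=> uc; rewrite excitationE.
rewrite -esum_fset_set; last 2 first.
- exact: finite_windowc.
- by move=> s _; exact: causal_kernel_ge0.
rewrite esum_mkcondr; apply: eq_esum => s Ns; case: ifPn => // snot.
rewrite /causal_kernel /patch memNset//= in_itv/= andbT subr_gt0 => su.
move/negP: snot; apply; apply/mem_set; rewrite /= in_itv/=.
by rewrite -lte_fin -s0r (Ns0 Ns)/= (le_trans (ltW su)).
Qed.

Lemma early_antitone n w s u : (s <= u)%R -> early N r0 n (u, w) ->
  early N r0 n (s, w).
Proof.
move=> su; rewrite /early; apply: le_trans; rewrite /running_sum/=.
rewrite esum_mkcondr [leRHS]esum_mkcondr; apply: le_esum => t _.
case: ifPn => [/set_mem|_]; last by case: ifPn.
rewrite /= in_itv/= => /andP[r0t ts]; rewrite mem_set//= in_itv/= r0t.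
exact: lt_le_trans su.
Qed.

(** A point s contributes to the intensity at u only if s < u, and if u is early
    then so is s; since g has mass 1, the early points s contribute at most rho
    each. *)
Lemma compensator_early n w :
  comp (earlyE n) w <= (mu * (c - r0))%:E + rho%:E * jump (earlyE n) w.
Proof.
set l := fset_set (N w `&` `]r0, c]).
have e0 x : 0 <= earlyE n x by rewrite lee_fin.
have msh s : measurable_fun [set: R] (fun u => gp (u - s)%R).
  apply: measurableT_comp; first exact: measurable_causal_kernel.
  exact: measurable_funB.
have sh s : \int[@lebesgue_measure R]_(u in `]r0, c]) gp (u - s)%R <= 1.
  rewrite -integral_causal_kernel.
  rewrite -(ge0_integral_shift (- s) measurable_causal_kernel causal_kernel_ge0).
  rewrite integral_mkcond; apply: ge0_le_integral_set => u _.
    by rewrite /patch; case: ifPn => // _; exact: causal_kernel_ge0.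
  by rewrite /patch; case: ifPn => // _; exact: causal_kernel_ge0.
rewrite (jump_sum_seq sN)// -/l.
apply: (@le_trans _ _ (\int[@lebesgue_measure R]_(u in `]r0, c])
  (mu%:E + rho%:E * \sum_(s <- l) earlyE n (s, w) * gp (u - s)%R))).
  apply: ge0_le_integral_set => u; rewrite /= in_itv/= => /andP[r0u uc].
    by rewrite mule_ge0// ?hawkes_lambda_ge0.
  rewrite hawkes_lambdaE excitation_seq// -/l.
  have [eu|neu] := boolP (early N r0 n (u, w)); last first.
    rewrite mul0e; apply: adde_ge0; first by rewrite lee_fin ltW.
    apply: mule_ge0; first by rewrite lee_fin ltW.
    by apply: sume_ge0 => s _; rewrite mule_ge0// causal_kernel_ge0.
  rewrite mul1e leeD2l//; apply: lee_wpmul2l; first by rewrite lee_fin ltW.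
  apply: lee_sum => s _; have [su|us] := leP s u.
    by rewrite (early_antitone su eu) mul1e.
  rewrite [X in X <= _](_ : _ = 0).
    by rewrite mule_ge0// causal_kernel_ge0.
  rewrite /causal_kernel /patch memNset//= in_itv/= andbT subr_gt0.
  by apply/negP; rewrite -leNgt ltW.
have mterm s : measurable_fun [set: R] (fun u => earlyE n (s, w) * gp (u - s)%R).
  exact: measurable_funeM.
have term0 s u : 0 <= earlyE n (s, w) * gp (u - s)%R.
  by rewrite mule_ge0// causal_kernel_ge0.
rewrite ge0_integralD//; first last.
- apply: measurable_funTS; apply: measurable_funeM.
  exact: emeasurable_sum.
- move=> u _; apply: mule_ge0; first by rewrite lee_fin ltW.
  exact: sume_ge0.
- by move=> u _; rewrite lee_fin ltW.
rewrite integral_cst//= lebesgue_measure_itv/= lte_fin.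
apply: leeD.
  case: ltP => // _; by rewrite mule0 lee_fin mulr_ge0 ?subr_ge0// ltW.
rewrite ge0_integralZl//; last 3 first.
- by apply: measurable_funTS; exact: emeasurable_sum.
- by move=> u _; exact: sume_ge0.
- by rewrite lee_fin ltW.
apply: lee_wpmul2l; first by rewrite lee_fin ltW.
rewrite ge0_integral_sum//; last first.
  by move=> s; exact: measurable_funTS (mterm s).
apply: lee_sum => s _; rewrite ge0_integralZl//; last 2 first.
- exact: measurable_funTS (msh s).
- by move=> u _; exact: causal_kernel_ge0.
by rewrite -[leRHS]mule1 lee_wpmul2l.
Qed.

(** The mean number of early points is at most n + 1, hence finite, and the
    inequality F <= mu (c - r0) + rho F can be solved for it. *)
Lemma mean_early n : EE (earlyE n) <= (mu * (c - r0) / (1 - rho))%:E.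
Proof.
have e0 x : 0 <= earlyE n x by rewrite lee_fin.
have me := @early_indicator _ _ _ N s0 sN r0 s0r0 n.
have camp := jump_sum_campbell hI s0r0 r0c e0 me.
have mJ := measurable_jump_sum sN s0r0 r0c e0 me.
have fin : EE (earlyE n) < +oo.
  rewrite -camp; apply: (@le_lt_trans _ _ (\int[P]_w (cst n.+1%:R%:E w))).
    apply: ge0_le_integral_set => w _; first exact: jump_sum_ge0.
    exact: jump_sum_early.
  rewrite integral_cst// [X in _ * X](_ : _ = 1) ?mule1 ?ltry//.
  exact: probability_setT.
have E0 : 0 <= EE (earlyE n) by exact: (mean_intensity_ge0 hI).
have : EE (earlyE n) <= (mu * (c - r0))%:E + rho%:E * EE (earlyE n).
  rewrite -[X in _ <= _ + _ * X]camp.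
  apply: (@le_trans _ _ (\int[P]_w ((mu * (c - r0))%:E +
    rho%:E * jump (earlyE n) w))).
    apply: ge0_le_integral_set => w _; first exact: (compensator_ge0 hI).
    exact: compensator_early.
  rewrite ge0_integralD//; first last.
  - exact: measurable_funeM.
  - move=> w _; apply: mule_ge0; first by rewrite lee_fin ltW.
    exact: jump_sum_ge0.
  - by move=> w _; rewrite lee_fin mulr_ge0 ?subr_ge0// ltW.
  rewrite integral_cst// [X in _ * X](_ : _ = 1); last exact: probability_setT.
  rewrite mule1 ge0_integralZl//; first by move=> w _; exact: jump_sum_ge0.
  by rewrite lee_fin ltW.
move: E0 fin; case: (EE _) => [x| |]//= _ _.
rewrite -EFinM -EFinD !lee_fin => h; rewrite ler_pdivlMr ?subr_gt0//; lra.
Qed.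

Lemma mean_intensity_started_empty :
  EE (cst 1) <= (mu * (c - r0) / (1 - rho))%:E.
Proof.
have c1 : EE (cst 1) = EE (cst 1 \* cst 1).
  by congr (mean_intensity _ _ _ _ _); apply/funext => x /=; rewrite mule1.
have cv := @cvg_mean_truncated_sqr _ _ _ P N s0 lam sN hI r0 c s0r0 r0c (cst 1)
  (fun=> lee01) (measurable_cst _).
rewrite c1; apply: (cvge_bound cv) => n; apply: le_trans (mean_early n).
rewrite le_eqVlt; apply/orP; left; apply/eqP.
congr (mean_intensity _ _ _ _ _); apply/funext => x /=.
rewrite /truncated !mule1.
by case: (early N r0 n x); [rewrite mule1|rewrite mule0].
Qed.

End started_empty.

End hawkes_mean.

(** * The mean number of points of the stationary process *)

Section stationary_mean.
Local Open Scope ereal_scope.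
Context (R : realType) (d : measure_display) (Omega : measurableType d)
  (P : probability Omega R) (N : Omega -> set R) (g : R -> R)
  (mu rho : R)
  (mu0 : (0 < mu)%R) (rho0 : (0 < rho)%R) (rho1 : (rho < 1)%R)
  (mg : measurable_fun (`[0%R, +oo[ : set R) g)
  (g0 : forall x, (0 <= x)%R -> (0 <= g x)%R)
  (g1 : \int[@lebesgue_measure R]_(x in `[0%R, +oo[) (g x)%:E = 1)
  (hN : hawkes_process P g -oo mu rho N).
Local Notation predictableT := (predictableT N -oo).
Local Notation predictable f := (measurable_fun [set: predictableT] (f : predictableT -> \bar R)).
Local Notation lam := (hawkes_lambda N g -oo mu rho).
Local Notation gp := (causal_kernel g).
Local Notation exc := (excitation N g -oo).
Local Notation leb := (@lebesgue_measure R).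

Let sN : simple_point_process N. Proof. by case: hN. Qed.
Let hI : has_stochastic_intensity P N -oo lam. Proof. by case: hN. Qed.
Let gp0 := causal_kernel_ge0 g0.
Let mgp := measurable_causal_kernel mg.
Let lam0 := hawkes_lambda_ge0 N -oo mu0 rho0 g0.
Let exc0 := excitation_ge0 N -oo g0.
Let NyR (x : R) : -oo <= x%:E. Proof. by rewrite leNye. Qed.

(** Stationarity is a statement on counts, so the argument works with the
    integrals of the mean rate over windows rather than with its values. *)
Definition mean_rate (s : R) : \bar R := \int[P]_w lam (s, w).
Local Notation L := mean_rate.

Definition mean_count (x y : R) : \bar R :=
  \int[P]_w counting (N w `&` `]x, y]).

Let mlam : measurable_fun [set: R * Omega] lam.
Proof. exact: (predictable_prod sN (predictable_intensity hI)). Qed.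

Lemma mean_rate_ge0 s : 0 <= L s.
Proof. by apply: integral_ge0 => w _. Qed.

Lemma measurable_mean_rate : measurable_fun [set: R] L.
Proof.
exact: (@measurable_fun_fubini_tonelli_F _ _ (measurableTypeR R) Omega R P lam
  mlam lam0).
Qed.

Lemma fubini_window (f : R * Omega -> \bar R) (x y : R) : (forall z, 0 <= f z) ->
  measurable_fun [set: R * Omega] f ->
  \int[P]_w \int[leb]_(t in `]x, y]) f (t, w) =
  \int[leb]_(t in `]x, y]) \int[P]_w f (t, w).
Proof.
move=> f0 mf.
pose h : R * Omega -> \bar R := f \_ (`]x, y] `*` setT).
have h0 z : 0 <= h z by rewrite /h /patch; case: ifPn.
have mh : measurable_fun [set: R * Omega] h.
  apply/(measurable_restrictT f); last exact: measurable_funTS.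
  by apply: measurableX.
have hE t w : h (t, w) = ((fun t => f (t, w)) \_ `]x, y]) t.
  rewrite /h /patch; congr (if _ then _ else _).
  by apply/idP/idP => /set_mem hh; apply/mem_set; [case: hh|split].
transitivity (\int[P]_w \int[leb]_t h (t, w)).
  apply: eq_integral => w _; rewrite integral_mkcond.
  by apply: eq_integral => t _; rewrite hE.
rewrite -(@fubini_tonelli _ _ (measurableTypeR R) Omega R leb P h mh h0).
rewrite [RHS]integral_mkcond; apply: eq_integral => t _.
rewrite /patch; case: ifPn => [tw|tw].
  by apply: eq_integral => w _; rewrite hE /patch tw.
by rewrite integral0_eq// => w _; rewrite hE /patch (negbTE tw).
Qed.

Lemma mean_count_rate x y : (x <= y)%R ->
  mean_count x y = \int[leb]_(t in `]x, y]) L t.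
Proof.
move=> xy; rewrite -(fubini_window x y lam0 mlam).
have camp := @jump_sum_campbell _ _ _ P N -oo lam hI x y (NyR x) xy (cst 1)
  (fun=> lee01) (measurable_cst _).
transitivity (\int[P]_w jump_sum N x y (cst 1) w).
  apply: eq_integral => w _; rewrite counting_esum//.
  exact: finite_windowc.
rewrite camp; apply: eq_integral => w _; apply: eq_integral => t _.
by rewrite mul1e.
Qed.

Lemma mean_count_shift x y h : mean_count (x + h)%R (y + h)%R = mean_count x y.
Proof.
have [stat _] : stationary_process P N /\
    (\int[P]_w counting (N w `&` `]0%R, 1%R]) < +oo)%E by case: hN => _ _ _; exact.
have mc u v : measurable_fun [set: Omega]
    (fun w => counting (N w `&` `]u, v]) : \bar R).
  by apply: sN.2.
have push u v : mean_count u v =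
    \int[pushforward P (fun w => counting (N w `&` `]u, v]) : \bar R)]_k `|k|.
  rewrite (ge0_integral_pushforward (mc u v) P measurableT)//.
  by apply: eq_integral => w _ /=; rewrite gee0_abs//; exact: measure_ge0.
have shiftE : [set s + h | s in `]x, y]]%R = `](x + h)%R, (y + h)%R]%classic.
  apply/seteqP; split => s /=.
    by move=> [r]; rewrite !in_itv/= => rxy <-; rewrite ltrD2r lerD2r.
  rewrite in_itv/= => sxy; exists (s - h)%R; last by rewrite subrK.
  by rewrite in_itv/= ltrBrDr lerBlDr.
rewrite !push; apply: eq_measure_integral => A mA _.
have := stat h 1%N (fun=> `]x, y]%classic) (fun=> A) (fun=> measurable_itv _)
  (fun=> mA).
rewrite shiftE; congr (_ = _); rewrite /pushforward; congr (P _).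
  by apply/seteqP; split => w /=; [move=> /(_ ord0)|].
by apply/seteqP; split => w /=; [move=> /(_ ord0)|].
Qed.

(** Split ]0, n] into unit windows, each with the finite mean count of
    ]0, 1]. *)
Lemma mean_count_fin T : (0 <= T)%R -> mean_count 0%R T < +oo.
Proof.
move=> T0.
have c1 : mean_count 0%R 1%R < +oo by case: hN => _ _ _ /(_ erefl)[].
have cn n : mean_count 0%R n%:R < +oo.
  elim: n => [|n ih].
    by rewrite mean_count_rate// set_itvoc0 integral_set0.
  have split_at : `]0%R, n%:R] `|` `]n%:R, n.+1%:R] = `]0%R, n.+1%:R : R]%classic.
    apply/seteqP; split => t /=; rewrite !in_itv/=.
      move=> [/andP[-> tn]|/andP[nt ->]]/=.
        by rewrite (le_trans tn)// ler_nat.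
      by rewrite andbT (le_lt_trans _ nt).
    by move=> /andP[-> ->]; case: (leP t n%:R); [left|right].
  rewrite mean_count_rate// -split_at ge0_integral_setU//=; last 3 first.
  - by apply: measurable_funTS; exact: measurable_mean_rate.
  - by move=> t _; exact: mean_rate_ge0.
  - apply/disj_set2P/seteqP; split => // t [] /=; rewrite !in_itv/=.
    by move=> /andP[_ tx] /andP[xt _]; have := lt_le_trans xt tx; rewrite ltxx.
  apply: lte_add_pinfty; first by move: ih; rewrite mean_count_rate.
  have := mean_count_shift 0 1 n%:R; rewrite add0r nat1r => sh.
  have nn1 : (n%:R <= n.+1%:R :> R)%R by rewrite ler_nat.
  by apply: le_lt_trans c1; rewrite -sh (mean_count_rate nn1).
apply: le_lt_trans (cn (Num.truncn T).+1).
rewrite !mean_count_rate//.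
rewrite integral_mkcond [leRHS]integral_mkcond; apply: ge0_le_integral_set => t _.
  by rewrite /patch; case: ifPn => // _; exact: mean_rate_ge0.
rewrite /patch; case: ifPn => [/set_mem|_]; last first.
  by case: ifPn => // _; exact: mean_rate_ge0.
rewrite /= in_itv/= => /andP[t0 tT]; rewrite mem_set//= in_itv/= t0/=.
by rewrite (le_trans tT)// ltW// truncnS_gt.
Qed.

(** Unlike in the case of a finite start, the whole time axis is predictable
    when s0 = -oo. *)
Lemma measurable_clock : measurable_fun [set: predictableT] (fst : predictableT -> R).
Proof.
apply: (measurability _ (RGenOInfty.measurableE R)) => //.
move=> _ [_ [q ->] <-]; rewrite setTI.
rewrite (_ : _ @^-1` _ = [set x : R * Omega | (q < x.1)%R /\ setT x.2]).
  by apply: measurable_after; [exact: NyR|exact: historyT].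
by apply/seteqP; split => x /=; rewrite in_itv/= andbT => // -[].
Qed.

(** The Campbell formula applied to the deterministic function
    s |-> g (t - s), after the change of variable r = t - s. *)
Lemma mean_excitation t :
  \int[P]_w exc (t, w) = \int[leb]_r (gp r * L (t - r)%R).
Proof.
pose C (x : R * Omega) := gp (t - x.1)%R.
have mts : measurable_fun [set: R] (fun s : R => (t - s)%R) by exact: measurable_funB.
have pC : predictable C.
  apply: (@measurableT_comp _ _ _ predictableT R (\bar R) (fun s => gp (t - s)%R) setT fst);
    last exact: measurable_clock.
  by apply: measurableT_comp => //; exact: measurable_funB.
have C0 x : 0 <= C x by exact: gp0.
have [_ _ _ /(_ C C0)] := hI.
have /predictable_funP pC' := pC.
move=> /(_ pC') camp.
transitivity (\int[P]_w \esum_(s in N w) C (s, w)).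
  by apply: eq_integral => w _; rewrite (excitationE hN).
rewrite camp.
have -> : [set s : R | -oo < s%:E] = setT by apply/seteqP; split => // s _ /=; exact: ltNyr.
have mlamw w : measurable_fun [set: R] (fun s => lam (s, w)).
  exact: measurableT_comp mlam (pair2_measurable w).
have mgl : measurable_fun [set: R * Omega] (fun z => gp z.1 * lam (t - z.1, z.2)%R).
  apply: emeasurable_funM; first exact: measurableT_comp mgp measurable_fst.
  apply: (measurableT_comp mlam); apply: measurable_fun_pair; last exact: measurable_snd.
  by apply: measurable_funB => //; exact: measurable_fst.
transitivity (\int[P]_w \int[leb]_r (gp r * lam (t - r, w)%R)).
  apply: eq_integral => w _.
  rewrite -(ge0_integral_reflect t (f := fun s => C (s, w) * lam (s, w))).
  - by apply: eq_integral => r _; rewrite /C/= subKr.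
  - apply: emeasurable_funM => //; exact: measurableT_comp mgp mts.
  - by move=> r; rewrite mule_ge0.
rewrite -(@fubini_tonelli _ _ (measurableTypeR R) Omega R leb P _ mgl); last first.
  by move=> z; rewrite mule_ge0.
apply: eq_integral => r _ /=; rewrite ge0_integralZl//.
have := measurableT_comp mlam (pair1_measurable (t - r)%R); exact.
Qed.

(** Exchange the two integrals; for each delay r the window ]0, T] shifted by r
    has the same mean count, and g has mass 1. *)
Lemma mean_excitation_window T : (0 <= T)%R ->
  \int[leb]_(t in `]0%R, T]) \int[P]_w exc (t, w) = mean_count 0%R T.
Proof.
move=> T0.
under eq_integral do rewrite mean_excitation.
pose k (z : R * R) : \bar R := ((fun t => gp z.2 * L (t - z.2)%R) \_ `]0%R, T]) z.1.
have k0 z : 0 <= k z.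
  by rewrite /k /patch; case: ifPn => // _; rewrite mule_ge0// mean_rate_ge0.
have mk : measurable_fun [set: R * R] k.
  pose k' : R * R -> \bar R := (fun z => gp z.2 * L (z.1 - z.2)%R) \_ (`]0%R, T] `*` setT).
  have -> : k = k'.
    apply/funext => z; rewrite /k /k' /patch; congr (if _ then _ else _).
    by apply/idP/idP => /set_mem hh; apply/mem_set; [split|case: hh].
  have mD : measurable (`]0%R, T] `*` setT : set (R * R)) by exact: measurableX.
  apply/(measurable_restrictT _ mD).
  apply: measurable_funTS; apply: emeasurable_funM.
    exact: measurableT_comp mgp measurable_snd.
  apply: (measurableT_comp measurable_mean_rate).
  by apply: measurable_funB; [exact: measurable_fst|exact: measurable_snd].
transitivity (\int[leb]_t \int[leb]_r k (t, r)).
  rewrite integral_mkcond; apply: eq_integral => t _; rewrite /k /patch/=.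
  by case: ifPn => // _; rewrite integral0.
rewrite (@fubini_tonelli _ _ (measurableTypeR R) (measurableTypeR R) R leb leb k mk k0).
transitivity (\int[leb]_r (gp r * mean_count 0%R T)).
  apply: eq_integral => r _.
  transitivity (gp r * \int[leb]_(t in `]0%R, T]) L (t - r)%R).
    rewrite -ge0_integralZl//.
    - by rewrite [RHS]integral_mkcond.
    - apply: measurable_funTS; apply: (measurableT_comp measurable_mean_rate).
      exact: measurable_funB.
    - by move=> t _; exact: mean_rate_ge0.
  congr (_ * _); apply: etrans _ (mean_count_shift 0 T (- r)).
  have rT : (0 + - r <= T + - r)%R by rewrite lerD2r.
  apply: etrans _ (esym (mean_count_rate rT)).
  rewrite integral_mkcond [RHS]integral_mkcond.
  rewrite -[RHS](ge0_integral_shift (- r)); last 2 first.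
  - apply/(measurable_restrictT L) => //; apply: measurable_funTS.
    exact: measurable_mean_rate.
  - by move=> s; rewrite /patch; case: ifPn => // _; exact: mean_rate_ge0.
  apply: eq_integral => t _; rewrite /patch; congr (if _ then _ else _).
  by apply/idP/idP => /set_mem hh; apply/mem_set; move: hh;
    rewrite /= !in_itv/= ltrD2r lerD2r.
rewrite ge0_integralZr//; last by apply: integral_ge0 => w _; exact: measure_ge0.
by rewrite (integral_causal_kernel mg g1) mul1e.
Qed.

(** The mean of lambda = mu + rho E over the window reads F = T mu + rho F; the
    finiteness of F is what allows one to solve for it. *)
Lemma mean_count_stationary T : (0 <= T)%R ->
  mean_count 0%R T = (T * mu / (1 - rho))%:E.
Proof.
move=> T0; have Ffin := mean_count_fin T0.
have F0 : 0 <= mean_count 0%R T by apply: integral_ge0 => w _; exact: measure_ge0.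
have mexc : measurable_fun [set: R * Omega] exc.
  apply: (predictable_prod sN); exact: (predictable_excitation rho0 hN).
have : mean_count 0%R T = (T * mu)%:E + rho%:E * mean_count 0%R T.
  rewrite -[in RHS](mean_excitation_window T0).
  have mH : measurable_fun [set: R] (fun t => \int[P]_w exc (t, w)).
    exact: (@measurable_fun_fubini_tonelli_F _ _ (measurableTypeR R) Omega R P
      exc mexc exc0).
  have H0 t : 0 <= \int[P]_w exc (t, w) by apply: integral_ge0.
  rewrite -ge0_integralZl//; last 2 first.
  - exact: measurable_funTS mH.
  - by rewrite lee_fin ltW.
  have -> : (T * mu)%:E = \int[leb]_(t in `]0%R, T]) (cst mu%:E t).
    rewrite integral_cst//= lebesgue_measure_itv/= lte_fin.
    case: ltP => [_|T0']; first by rewrite sube0 -EFinM mulrC.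
    have -> : T = 0%R by apply/le_anti; rewrite T0'.
    by rewrite mul0r mule0.
  rewrite -ge0_integralD//; last 3 first.
  - by move=> t _; rewrite lee_fin ltW.
  - by move=> t _; rewrite mule_ge0// lee_fin ltW.
  - by apply: measurable_funeM; exact: measurable_funTS mH.
  rewrite mean_count_rate//; apply: eq_integral => t _.
  rewrite /mean_rate.
  have mexct : measurable_fun [set: Omega] (fun w => exc (t, w)).
    exact: measurableT_comp mexc (pair1_measurable t).
  under eq_integral do rewrite hawkes_lambdaE.
  rewrite ge0_integralD//; last 3 first.
  - by move=> w _; rewrite lee_fin ltW.
  - by move=> w _; rewrite mule_ge0// lee_fin ltW.
  - exact: measurable_funeM.
  rewrite integral_cst// [X in _ * X](_ : _ = 1); last exact: probability_setT.
  by rewrite mule1 ge0_integralZl// lee_fin ltW.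
move: F0 Ffin; case: (mean_count _ _) => [x| |]//= _ _.
rewrite -EFinM -EFinD => -[h]; congr (_%:E).
by apply: (mulIf (x := (1 - rho)%R)); rewrite ?divfK ?gt_eqF ?subr_gt0//; lra.
Qed.

End stationary_mean.

(** * Partial derivatives of the log-likelihood *)

Section partial_derivatives.
Context (R : realType).

Lemma partial_along_line (f : 'rV[R]_2 -> R) (v : 'rV[R]_2) (i : 'I_2)
    (phi : R -> R) (dphi : R) :
  (\forall h \near (0 : R), phi h = f (h *: delta_mx 0 i + v)) ->
  is_derive (0 : R) (1 : R) phi dphi -> partial f v i = dphi.
Proof.
move=> fphi dp.
have [_ <-] := near_eq_is_derive fphi dp.
rewrite /partial /derive; congr (lim _).
have -> // : (fun h : R => h^-1 *: ((f \o shift v) (h *: delta_mx 0 i) - f v)) =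
  (fun h : R => h^-1 *: (((fun k => f (k *: delta_mx 0 i + v)) \o shift 0)
    (h *: (1 : R)) - f ((0 : R) *: delta_mx 0 i + v))).
apply/funext => h /=; rewrite addr0 scale0r add0r.
by rewrite [h%:A]mulr1.
Qed.

Lemma is_derive_addf (f k : R -> R) (x df dk : R) :
  is_derive x (1 : R) f df -> is_derive x (1 : R) k dk ->
  is_derive x (1 : R) (fun h => f h + k h) (df + dk).
Proof. by move=> hf hk; have := is_deriveD hf hk. Qed.

Lemma is_derive_subf (f k : R -> R) (x df dk : R) :
  is_derive x (1 : R) f df -> is_derive x (1 : R) k dk ->
  is_derive x (1 : R) (fun h => f h - k h) (df - dk).
Proof. by move=> hf hk; have := is_deriveB hf hk. Qed.

Lemma is_derive_mulr (f : R -> R) (x df c : R) :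
  is_derive x (1 : R) f df -> is_derive x (1 : R) (fun h => f h * c) (df * c).
Proof.
move=> hf; have -> : (fun h => f h * c) = c \*: f.
  by apply/funext => h; exact: mulrC.
by rewrite mulrC; exact: is_deriveZ.
Qed.

Lemma is_derive_sum_seq (T : Type) (s : seq T) (F : T -> R -> R) (dF : T -> R)
    (x : R) : (forall t, is_derive x (1 : R) (F t) (dF t)) ->
  is_derive x (1 : R) (fun h => \sum_(t <- s) F t h) (\sum_(t <- s) dF t).
Proof.
move=> dFt; elim: s => [|t s ih].
  rewrite big_nil; under eq_fun do rewrite big_nil; exact: is_derive_cst.
rewrite big_cons; under eq_fun do rewrite big_cons.
exact: is_derive_addf.
Qed.

End partial_derivatives.

Section likelihood_derivatives.
Context (R : realType) (g : R -> R) (s0 : \bar R) (X : set R) (v : 'rV[R]_2)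
  (i : 'I_2) (k0 k1 : R -> R) (d0 d1 : R).
Context (g0 : forall x, 0 <= x -> 0 <= g x).

Let E (t : R) : \bar R :=
  \esum_(s in X `&` [set s | (s0 < s%:E)%E /\ s < t]) (g (t - s))%:E.

(* Along the coordinate line the intensity is affine in E, with coefficients
   that depend on the parameter only. *)
Context (lineE : forall h t, param_intensity g s0 (h *: delta_mx 0 i + v) X t =
    ((k0 h)%:E + (k1 h)%:E * E t)%E)
  (k0_gt0 : 0 < k0 0) (k1_gt0 : 0 < k1 0)
  (dk0 : is_derive (0 : R) (1 : R) k0 d0)
  (dk1 : is_derive (0 : R) (1 : R) k1 d1).

Let E_ge0 t : (0 <= E t)%E.
Proof.
by apply: esum_ge0 => s [_ [_ st]]; rewrite lee_fin g0// subr_ge0 ltW.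
Qed.

(* the two coefficients stay positive near 0: this keeps the logarithm
   differentiable and an infinite intensity infinite *)
Let near_pos (k : R -> R) (d : R) : 0 < k 0 -> is_derive (0 : R) (1 : R) k d ->
  \forall h \near (0 : R), 0 < k h.
Proof.
move=> kp [dk _]; have kc : {for (0 : R), continuous k}.
  exact/differentiable_continuous/derivable1_diffP.
exact: cvgr_gt kc _ kp.
Qed.

(** Where E is infinite so is the intensity, for every value of the parameter
    with b > 0, and its finite part is the constant 0. *)
Lemma fine_affine (a b : R) t : 0 < b ->
  fine (a%:E + b%:E * E t)%E =
  if E t \is a fin_num then a + b * fine (E t) else 0.
Proof.
move=> b0; have := E_ge0 t; case: (E t) => [e| |]//= _.
by rewrite gt0_muley ?lte_fin.
Qed.

Lemma partial_intensity t :
  partial (fun u => fine (param_intensity g s0 u X t)) v i =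
  if E t \is a fin_num then d0 + d1 * fine (E t) else 0.
Proof.
apply: (@partial_along_line _ _ _ _
  (fun h => if E t \is a fin_num then k0 h + k1 h * fine (E t) else 0)).
  have := near_pos k1_gt0 dk1; apply: filterS => h kh.
  by rewrite lineE fine_affine.
case: ifP => _; last exact: is_derive_cst.
by apply: is_derive_addf => //; exact: is_derive_mulr.
Qed.

Context (T : R) (T0 : 0 <= T) (fX : finite_set (X `&` `]0, T]))
  (mE : measurable_fun (`[0, T] : set R) E)
  (HE : (\int[@lebesgue_measure R]_(t in `[0%R, T]) E t \is a fin_num)%E).

Lemma partial_loglik :
  partial (loglik g s0 T X) v i =
  \sum_(t <- fset_set (X `&` `]0, T]))
     ((if E t \is a fin_num then d0 + d1 * fine (E t) else 0) /
      fine (param_intensity g s0 v X t))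
  - (d0 * T + d1 * fine (\int[@lebesgue_measure R]_(t in `[0%R, T]) E t)%E).
Proof.
have HE' := HE; set H := (\int[_]_(_ in _) _)%E in HE' *.
apply: (@partial_along_line _ _ _ _ (fun h =>
  \sum_(t <- fset_set (X `&` `]0, T]))
    ln (if E t \is a fin_num then k0 h + k1 h * fine (E t) else 0)
  - (k0 h * T + k1 h * fine H))).
  near=> h.
  have kh0 : 0 < k0 h by near: h; exact: near_pos k0_gt0 dk0.
  have kh1 : 0 < k1 h by near: h; exact: near_pos k1_gt0 dk1.
  rewrite /loglik fsbig_finite//=; congr (_ - _).
    by apply: eq_bigr => t _; rewrite lineE fine_affine.
  under eq_integral do rewrite lineE.
  rewrite ge0_integralD//; first last.
  - exact: measurable_funeM.
  - by move=> t _; rewrite mule_ge0// lee_fin ltW.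
  - by move=> t _; rewrite lee_fin ltW.
  rewrite integral_cst//= lebesgue_measure_itv/= lte_fin.
  rewrite ge0_integralZl//; last by rewrite lee_fin ltW.
  rewrite -/H -(fineK HE').
  case: ltP => [_|T0']; first by rewrite sube0.
  have -> : T = 0 by apply/le_anti; rewrite T0 T0'.
  by rewrite mule0 mulr0.
have dline t : is_derive (0 : R) (1 : R) (fun h => k0 h + k1 h * fine (E t))
    (d0 + d1 * fine (E t)).
  by apply: is_derive_addf => //; exact: is_derive_mulr.
have lam0 t : param_intensity g s0 v X t =
    ((k0 0)%:E + (k1 0)%:E * E t)%E by rewrite -lineE scale0r add0r.
apply: is_derive_subf.
  apply: is_derive_sum_seq => t.
  rewrite lam0 fine_affine//; case: ifPn => [_|_]; last first.
    by rewrite mul0r; exact: is_derive_cst.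
  have pos : 0 < k0 0 + k1 0 * fine (E t).
    by rewrite ltr_wpDr// mulr_ge0 ?(ltW k1_gt0)// fine_ge0.
  rewrite mulrC; exact: (@is_derive1_comp _ (@ln R) (fun h => k0 h + k1 h * fine (E t))
    _ _ _ (is_derive1_ln pos) (dline t)).
by apply: is_derive_addf; exact: is_derive_mulr.
Unshelve. all: by end_near.
Qed.

End likelihood_derivatives.

(** * The score as a compensated integral *)

Lemma measurable_invr (R : realType) :
  measurable_fun [set: R] (fun x : R => x^-1).
Proof.
have -> : [set: R] = [set x : R | x != 0] `|` [set 0].
  by apply/seteqP; split => // x _; have [->|x0] := eqVneq x 0; [right|left].
have o0 : open [set x : R | x != 0] by exact: open_neq.
apply/measurable_funU => //; first exact: open_measurable.
split; last exact: measurable_fun_set1.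
by apply: open_continuous_measurable_fun => // x /set_mem x0; exact: inv_continuous.
Qed.

(** The two restrictions of f differ at the point a alone. *)
Lemma integral_itv_cc_oc (R : realType) (f : R -> \bar R) (a b : R) :
  (\int[@lebesgue_measure R]_(t in `[a, b]) f t =
   \int[@lebesgue_measure R]_(t in `]a, b]) f t)%E.
Proof.
rewrite integral_mkcond [RHS]integral_mkcond; apply: eq_integral_ae.
exists [set a]; split; [exact: measurable_set1|exact: lebesgue_measure_set1|].
move=> t /= h; apply: contrapT => ta; apply: h; rewrite /patch.
suff -> : (t \in `[a, b]%classic) = (t \in `]a, b]%classic) by [].
apply/idP/idP => /set_mem; rewrite /= in_itv/= => /andP[at' tb]; apply/mem_set.
  rewrite /= in_itv/= tb andbT lt_neqAle at' andbT; apply/eqP => e.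
  by apply: ta; rewrite e.
by rewrite /= in_itv/= tb andbT ltW.
Qed.

Lemma aeS d (T : measurableType d) (R : realType)
    (m : {measure set T -> \bar R}) (A B : T -> Prop) :
  (forall x, A x -> B x) -> {ae m, forall x, A x} -> {ae m, forall x, B x}.
Proof. by move=> AB; apply: filterS. Qed.

Lemma covariance_centered d (T : measurableType d) (R : realType)
    (P : probability T R) (X Y : T -> R) :
  (\int[P]_w (X w)%:E = 0)%E -> (\int[P]_w (Y w)%:E = 0)%E ->
  (covariance P X Y = \int[P]_w (X w * Y w)%:E)%E.
Proof.
move=> X0 Y0; rewrite covariance.unlock !expectation.unlock X0 Y0.
apply: eq_integral => w _; congr (_%:E).
by rewrite -[LHS]/((X w - 0) * (Y w - 0)) !subr0.
Qed.

Section hawkes_fisher.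
Local Open Scope ereal_scope.
Context (R : realType) (d : measure_display) (Omega : measurableType d)
  (P : probability Omega R) (N : Omega -> set R) (g : R -> R) (s0 : \bar R)
  (mu rho T : R) (hs0 : s0 <= 0%:E) (T0 : (0 < T)%R)
  (mu0 : (0 < mu)%R) (rho0 : (0 < rho)%R) (rho1 : (rho < 1)%R)
  (mg : measurable_fun (`[0%R, +oo[ : set R) g)
  (g0 : forall x, (0 <= x)%R -> (0 <= g x)%R)
  (g1 : \int[@lebesgue_measure R]_(x in `[0%R, +oo[) (g x)%:E = 1)
  (hN : hawkes_process P g s0 mu rho N).
Local Notation predictableT := (predictableT N s0).
Local Notation predictable f := (measurable_fun [set: predictableT] (f : predictableT -> \bar R)).
Local Notation lam := (hawkes_lambda N g s0 mu rho).
Local Notation exc := (excitation N g s0).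
Local Notation EE := (mean_intensity P lam 0%R T).
Local Notation comp := (compensator lam 0%R T).
Local Notation jump := (jump_sum N 0%R T).
Local Notation M := (compensated N lam 0%R T).
Local Notation leb := (@lebesgue_measure R).
Local Notation v0 := (hawkes_param mu rho).

Let sN : simple_point_process N. Proof. by case: hN. Qed.
Let hI : has_stochastic_intensity P N s0 lam. Proof. by case: hN. Qed.
Let lam0 := hawkes_lambda_ge0 N s0 mu0 rho0 g0.
Let exc0 := excitation_ge0 N s0 g0.
Let T0' : (0 <= T)%R. Proof. exact: ltW. Qed.
Let rho1' : (0 < 1 - rho)%R. Proof. by rewrite subr_gt0. Qed.

Lemma jump_sum_count w : jump (cst 1) w = counting (N w `&` `]0%R, T]).
Proof. by rewrite counting_esum//; exact: finite_windowc. Qed.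

Lemma mean_points_stationary : s0 = -oo -> EE (cst 1) = (T * mu / (1 - rho))%:E.
Proof.
move=> s0y; rewrite -(@jump_sum_campbell _ _ _ _ _ _ _ hI _ _ hs0 T0' (cst 1)
  (fun=> lee01) (measurable_cst _)).
under eq_integral do rewrite jump_sum_count.
by move: hN; rewrite s0y => hNy; exact: (mean_count_stationary mu0 rho0 rho1 mg g0 g1 hNy).
Qed.

(** In the case of a finite start the window ]0, T] is part of the whole
    history ]s0, T]. *)
Lemma mean_points_fin : EE (cst 1) < +oo.
Proof.
have [s0y|] := eqVneq s0 -oo; first by rewrite mean_points_stationary// ltry.
move=> s0Ny; have s0fin : s0 \is a fin_num.
  by rewrite fin_numE s0Ny/=; apply/eqP => s0y; move: hs0; rewrite s0y.
have s0r : s0 = (fine s0)%:E by rewrite fineK.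
have r0 : (fine s0 <= 0)%R by rewrite -lee_fin -s0r.
have r0T : (fine s0 <= T)%R by exact: le_trans r0 T0'.
have E1 := mean_intensity_started_empty mu0 rho0 rho1 mg g0 g1 hN s0r r0T.
apply: le_lt_trans (ltry _) => //; apply: le_trans E1.
apply: ge0_le_integral_set => w _; first exact: (compensator_ge0 hI).
rewrite /compensator integral_mkcond [leRHS]integral_mkcond.
apply: ge0_le_integral_set => t _; rewrite /patch.
  by case: ifPn => // _; rewrite mule_ge0.
case: ifPn => [/set_mem|_]; last by case: ifPn => // _; rewrite mule_ge0.
rewrite /= in_itv/= => /andP[t0 tT]; rewrite mem_set//= in_itv/= tT andbT.
exact: le_lt_trans t0.
Qed.

(** The shares of the baseline and, up to the factor (1 - rho) / rho, of the
    excitation in the intensity.  As fine +oo = 0 and x / 0 = 0 both vanish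
    where the intensity is infinite. *)
Definition score_weight (i : 'I_2) (x : R * Omega) : R :=
  (if i == ord0 then mu / fine (lam x)
   else (1 - rho) * fine (exc x) / fine (lam x))%R.
Local Notation psi i := (EFin \o score_weight i).

(** Weights are kept nonnegative; log (1 - rho) decreases the intensity. *)
Definition score_sign (i : 'I_2) : R := if i == ord0 then 1%R else (- 1)%R.

Lemma score_sign_sqr i : (score_sign i * score_sign i = 1)%R.
Proof. by rewrite /score_sign; case: ifP; rewrite ?mulr1// mulrNN mulr1. Qed.

Lemma lambda_cases x :
  (exists2 e : R, (0 <= e)%R & exc x = e%:E /\ lam x = (mu + rho * e)%:E) \/
  (exc x = +oo /\ lam x = +oo).
Proof.
have := exc0 x; rewrite hawkes_lambdaE; case: (exc x) => [e| |]//=.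
  by rewrite lee_fin => e0; left; exists e.
by move=> _; right; rewrite gt0_muley ?lte_fin.
Qed.

Lemma fine_lambda_cases x :
  (exists2 e : R, (0 <= e)%R & exc x = e%:E /\ lam x = (mu + rho * e)%:E) \/
  fine (lam x) = 0%R.
Proof. by case: (lambda_cases x) => [|[_ ->]]; [left|right]. Qed.

Lemma score_weight_ge0 i x : 0 <= psi i x.
Proof.
rewrite /= lee_fin /score_weight.
by case: ifPn => _; rewrite !mulr_ge0 ?invr_ge0 ?fine_ge0// ltW.
Qed.

Lemma score_weight_le i x : psi i x <= (rho^-1)%:E.
Proof.
rewrite /= lee_fin /score_weight.
have ir1 : (1 <= rho^-1)%R by rewrite invf_ge1// ltW.
have [[e e0 [-> ->]]|->] := fine_lambda_cases x; last first.
  by rewrite invr0 !mulr0; case: ifP => _; rewrite invr_ge0 ltW.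
have pos : (0 < mu + rho * e)%R by rewrite ltr_pwDl// mulr_ge0// ltW.
case: ifP => _ /=; rewrite ler_pdivrMr//.
  rewrite (le_trans _ (ler_wpM2r (ltW pos) ir1))// mul1r lerDl mulr_ge0//.
  exact: ltW.
rewrite mulrDr mulKf ?gt_eqF//; apply: (@le_trans _ _ e).
  by rewrite ler_piMl// lerBlDr lerDl ltW.
by rewrite lerDr mulr_ge0 ?invr_ge0// ltW.
Qed.

Lemma measurable_score_weight i : predictable (psi i).
Proof.
have ml : measurable_fun [set: predictableT] (fine \o lam : predictableT -> R).
  by apply: measurableT_comp => //; exact: predictable_intensity hI.
have me : measurable_fun [set: predictableT] (fine \o exc : predictableT -> R).
  by apply: measurableT_comp => //; exact: predictable_excitation rho0 hN.
have mi : measurable_fun [set: predictableT] (fun x => (fine (lam x))^-1%R : R).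
  exact: measurableT_comp (@measurable_invr R) ml.
apply/measurable_EFinP; rewrite /score_weight; case: (i == ord0).
  exact: measurable_funM.
by apply: measurable_funM => //; exact: measurable_funM.
Qed.

Lemma mean_score_weight_fin i : EE (psi i) < +oo.
Proof.
apply: (@le_lt_trans _ _ (EE (fun x => (rho^-1)%:E * cst 1 x))).
  apply: (le_mean_intensity hI) => x; first exact: score_weight_ge0.
  by rewrite /= mule1; exact: score_weight_le.
rewrite (mean_intensityZ sN hI hs0 T0')//.
- by rewrite lte_mul_pinfty// ?lee_fin ?invr_ge0 ?(ltW rho0)//; exact: mean_points_fin.
- by rewrite invr_ge0 ltW.
Qed.

(* Baseline and branching ratio at distance h from the true parameter along the
   i-th coordinate, and their derivatives at h = 0. *)
Let k0 (i : 'I_2) (h : R) : R := if i == ord0 then (mu * expR h)%R else mu.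
Let k1 (i : 'I_2) (h : R) : R :=
  if i == ord0 then rho else (1 - (1 - rho) * expR h)%R.
Let d0 (i : 'I_2) : R := if i == ord0 then mu else 0%R.
Let d1 (i : 'I_2) : R := if i == ord0 then 0%R else (- (1 - rho))%R.

Let lineE i X h t : param_intensity g s0 (h *: delta_mx 0 i + v0)%R X t =
  (k0 i h)%:E + (k1 i h)%:E *
  \esum_(s in X `&` [set s | s0 < s%:E /\ (s < t)%R]) (g (t - s)%R)%:E.
Proof.
rewrite /param_intensity /hawkes_intensity !mxE /= /k0 /k1.
have i01 : i = 0%R \/ i = 1%R by case: i => -[|[|//]] p; [left|right]; exact: val_inj.
case: i01 => -> /=; rewrite ?mulr0 ?mulr1 ?add0r.
  by rewrite expRD !lnK ?posrE// [(expR h * mu)%R]mulrC subKr.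
by rewrite expRD !lnK ?posrE// [(expR h * _)%R]mulrC.
Qed.

Let k0_gt0 i : (0 < k0 i 0)%R.
Proof. by rewrite /k0 expR0 mulr1; case: ifP. Qed.

Let k1_gt0 i : (0 < k1 i 0)%R.
Proof. by rewrite /k1 expR0 mulr1 subKr; case: ifP. Qed.

Let dk0 i : is_derive (0 : R)%R (1 : R)%R (k0 i) (d0 i).
Proof.
rewrite /k0 /d0; case: ifP => _; last exact: is_derive_cst.
have := @is_derive_mulr R expR 0%R _ mu (is_derive_expR 0%R).
rewrite expR0 mul1r; congr (is_derive _ _ _ _).
by apply/funext => h; rewrite mulrC.
Qed.

Let dk1 i : is_derive (0 : R)%R (1 : R)%R (k1 i) (d1 i).
Proof.
rewrite /k1 /d1; case: ifP => _; first exact: is_derive_cst.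
have c1 : is_derive (0 : R)%R (1 : R)%R (cst (1 : R)%R) (0 : R)%R.
  exact: is_derive_cst.
have := is_derive_subf c1
  (@is_derive_mulr R expR 0%R _ (1 - rho)%R (is_derive_expR 0%R)).
rewrite expR0 mul1r sub0r; congr (is_derive _ _ _ _).
by apply/funext => h; rewrite mulrC.
Qed.

Lemma param_intensity_true w t : param_intensity g s0 v0 (N w) t = lam (t, w).
Proof.
have := lineE 0%R (N w) 0%R t; rewrite scale0r add0r => ->.
by rewrite /k0 /k1/= expR0 mulr1.
Qed.

Let line_derivative i x :
  (if exc x \is a fin_num then d0 i + d1 i * fine (exc x) else 0)%R =
  (score_sign i * score_weight i x * fine (lam x))%R.
Proof.
rewrite /d0 /d1 /score_sign /score_weight.
have [[e e0 [-> ->]]|[-> ->]] := lambda_cases x => /=; last by rewrite mulr0.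
have pos : (0 < mu + rho * e)%R by rewrite ltr_pwDl// mulr_ge0// ltW.
case: ifP => _; rewrite -mulrA divfK ?gt_eqF//; ring.
Qed.

Lemma partial_hawkes_intensity i w t :
  partial (fun u => fine (param_intensity g s0 u (N w) t)) v0 i =
  (score_sign i * score_weight i (t, w) * fine (lam (t, w)))%R.
Proof.
rewrite (partial_intensity g0 (lineE i (N w)) (k1_gt0 i) (dk0 i) (dk1 i)).
exact: (line_derivative i (t, w)).
Qed.

(** The intensity has a finite mean integral, so it is almost surely finite at
    almost every time. *)
Lemma intensity_fin_ae : {ae P, forall w,
  comp (cst 1) w \is a fin_num /\
  {ae (leb : {measure set (measurableTypeR R) -> \bar R}),
    forall t, `]0%R, T]%classic t -> lam (t, w) \is a fin_num}}.
Proof.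
have mlamw w : measurable_fun [set: R] (fun t => lam (t, w)).
  exact: (predictable_path sN w (predictable_intensity hI)).
have := compensator_fin_ae sN hI hs0 T0' (fun=> lee01) (measurable_cst _)
  mean_points_fin.
apply: filterS => w cw; split => //.
have ilam : leb.-integrable `]0%R, T] (fun t => lam (t, w)).
  apply/integrableP; split; first exact: (measurable_funTS (mlamw w)).
  rewrite (_ : \int[_]_(_ in _) _ = comp (cst 1) w).
    by rewrite -ge0_fin_numE// (compensator_ge0 hI).
  by apply: eq_integral => t _; rewrite gee0_abs// mul1e.
have mI : measurable (`]0%R, T] : set (measurableTypeR R)) by exact: measurable_itv.
have h := integrable_ae mI ilam; exact: h.
Qed.

Lemma mean_baseline_weight : EE (psi ord0) = (mu * T)%:E.
Proof.
transitivity (\int[P]_w (cst (mu * T)%:E w)); last first.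
  rewrite integral_cst// [X in _ * X](_ : _ = 1) ?mule1//.
  exact: probability_setT.
apply: eq_integral_ae; apply: filterS intensity_fin_ae => w [_ lw].
transitivity (\int[leb]_(t in `]0%R, T]) (cst mu%:E t)).
  apply: eq_integral_ae_set; apply: aeS lw => t /[apply].
  rewrite /score_weight/=.
  have [[e e0 [_ ->]] _|[_ ->]//] := lambda_cases (t, w).
  rewrite -EFinM; congr (_%:E).
  by rewrite divfK// gt_eqF// ltr_pwDl// mulr_ge0// ltW.
by rewrite integral_cst//= lebesgue_measure_itv/= lte_fin T0 sube0 -EFinM.
Qed.

(** Equal to 1 up to a null set; the relation between the weights fails where
    the intensity is infinite, and this factor corrects it there. *)
Definition finite_lambda (x : R * Omega) : \bar R := (lam x \is a fin_num)%:R%:E.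

Lemma mean_finite_lambda : EE finite_lambda = EE (cst 1).
Proof.
apply: eq_integral_ae; apply: filterS intensity_fin_ae => w [_ lw].
apply: eq_integral_ae_set; apply: aeS lw => t /[apply] h.
by rewrite /finite_lambda h.
Qed.

Lemma score_weight_relation x :
  (rho * score_weight 1 x + (1 - rho) * score_weight 0 x =
   (1 - rho) * (lam x \is a fin_num)%:R)%R.
Proof.
rewrite /score_weight/=.
have [[e e0 [-> ->]]|[-> ->]] := lambda_cases x => /=; last first.
  by rewrite invr0 !mulr0 addr0.
have pos : (0 < mu + rho * e)%R by rewrite ltr_pwDl// mulr_ge0// ltW.
by field; rewrite gt_eqF.
Qed.

Lemma score_weight_finite i x :
  (score_weight i x * (lam x \is a fin_num)%:R = score_weight i x)%R.
Proof.
rewrite /score_weight.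
have [[e e0 [-> ->]]|[-> ->]] := lambda_cases x => /=; first by rewrite mulr1.
by rewrite invr0 !mulr0; case: ifP.
Qed.

Lemma sqr_baseline_weight x :
  (psi ord0 x * psi ord0 x) * lam x = mu%:E * psi ord0 x.
Proof.
rewrite /score_weight/=.
have [[e e0 [_ ->]]|[_ ->]] := lambda_cases x => /=; last first.
  by rewrite invr0 !mulr0 !mule0 mul0e.
have pos : (0 < mu + rho * e)%R by rewrite ltr_pwDl// mulr_ge0// ltW.
by rewrite -!EFinM; congr (_%:E); field; rewrite gt_eqF.
Qed.

(** The logarithmic derivative of the intensity at a point is its signed weight,
    and the derivative of the integral of the intensity is the signed
    compensator of the weight as soon as the excitation has a finite
    integral. *)
Lemma score_compensated i : {ae P, forall w,
  score N g s0 T v0 i w = (score_sign i * M (psi i) w)%R}.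
Proof.
apply: filterS intensity_fin_ae => w [cw lw].
have mexc : measurable_fun [set: R] (fun t => exc (t, w)).
  exact: (predictable_path sN w (predictable_excitation rho0 hN)).
have He : \int[leb]_(t in `[0%R, T]) exc (t, w) \is a fin_num.
  rewrite ge0_fin_numE; last by apply: integral_ge0.
  rewrite integral_itv_cc_oc; apply: (@le_lt_trans _ _ ((rho^-1)%:E * comp (cst 1) w)).
    have mlw : measurable_fun `]0%R, T] (fun t => cst 1 (t, w) * lam (t, w)).
      apply: measurable_funTS; apply: emeasurable_funM => //.
      exact: (predictable_path sN w (predictable_intensity hI)).
    rewrite /compensator -ge0_integralZl//; last 2 first.
    - by move=> t _; rewrite mule_ge0.
    - by rewrite lee_fin invr_ge0 ltW.
    apply: ge0_le_integral_set => // t _.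
    have {1}-> : exc (t, w) = (rho^-1)%:E * (rho%:E * exc (t, w)).
      by rewrite muleA -EFinM mulVf ?gt_eqF// mul1e.
    apply: lee_wpmul2l; first by rewrite lee_fin invr_ge0 ltW.
    by rewrite mul1e hawkes_lambdaE leeDr// lee_fin ltW.
  rewrite lte_mul_pinfty// ?lee_fin ?invr_ge0 ?(ltW rho0)//.
  by rewrite -ge0_fin_numE// (compensator_ge0 hI).
rewrite /score (partial_loglik g0 (lineE i (N w)) (k0_gt0 i) (k1_gt0 i) (dk0 i)
  (dk1 i) T0' (finite_windowc sN w _ _) (measurable_funTS mexc) He).
have compE : comp (psi i) w = (score_sign i *
    (d0 i * T + d1 i * fine (\int[leb]_(t in `[0%R, T]) exc (t, w))))%:E.
  have bound (a b : R) : (0 <= a)%R -> (0 <= b)%R ->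
      \int[leb]_(t in `]0%R, T]) (a%:E + b%:E * exc (t, w)) =
      (a * T + b * fine (\int[leb]_(t in `[0%R, T]) exc (t, w)))%:E.
    move=> a0 b0; rewrite ge0_integralD//; first last.
    - by apply: measurable_funeM; exact: measurable_funTS mexc.
    - by move=> t _; rewrite mule_ge0.
    rewrite integral_cst//= lebesgue_measure_itv/= lte_fin T0 sube0.
    rewrite ge0_integralZl//; last exact: measurable_funTS mexc.
    by rewrite EFinD !EFinM fineK// integral_itv_cc_oc.
  transitivity (\int[leb]_(t in `]0%R, T]) ((score_sign i * d0 i)%:E +
      (score_sign i * d1 i)%:E * exc (t, w))).
    apply: eq_integral_ae_set; apply: aeS lw => t /[apply].
    have ld := line_derivative i (t, w); move: ld.
    have [[e e0 [-> ->]]|[-> ->]//] := lambda_cases (t, w) => /= ld _.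
    rewrite -!EFinM -EFinD; congr (_%:E).
    have -> : (score_sign i * d0 i + score_sign i * d1 i * e =
        score_sign i * (d0 i + d1 i * e))%R by ring.
    by rewrite ld !mulrA score_sign_sqr mul1r.
  rewrite bound.
  - by congr (_%:E); ring.
  - rewrite /score_sign /d0; case: ifP => _; first by rewrite mul1r ltW.
    by rewrite mulr0.
  - rewrite /score_sign /d1; case: ifP => _; first by rewrite mulr0.
    by rewrite mulrNN mul1r ltW.
rewrite /compensated compE mulrBr; congr (_ - _)%R.
  rewrite (jump_sum_seq sN)//; last by move=> x; exact: score_weight_ge0.
  rewrite sumEFin/= mulr_sumr; apply: eq_bigr => t _.
  rewrite param_intensity_true (line_derivative i (t, w)).
  rewrite -!mulrA; congr (_ * _)%R.
  rewrite /score_weight; have [[e e0 [-> ->]]|->] := fine_lambda_cases (t, w).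
    have pos : (0 < mu + rho * e)%R by rewrite ltr_pwDl// mulr_ge0// ltW.
    by rewrite divff ?mulr1// gt_eqF.
  by rewrite invr0 !mulr0; case: ifP.
by rewrite mulrA /= score_sign_sqr mul1r.
Qed.

(** Almost surely the scores are the signed compensated integrals of the
    weights, to which the isometry applies as these are bounded. *)
Lemma fisher_info_weights i j : fisher_info P N g s0 T v0 i j =
  (score_sign i * score_sign j)%:E * EE (psi i \* psi j).
Proof.
have W0 := score_weight_ge0; have WC := score_weight_le.
have mW := measurable_score_weight; have EW := mean_score_weight_fin.
have mean0 k : \int[P]_w (score N g s0 T v0 k w)%:E = 0.
  transitivity (\int[P]_w ((score_sign k)%:E * (M (psi k) w)%:E)).
    apply: eq_integral_ae; apply: filterS (score_compensated k) => w ->.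
    by rewrite EFinM.
  rewrite integralZl//.
    by rewrite (compensated_mean0 sN hI hs0 T0' (W0 k) (WC k) (mW k) (EW k)) mule0.
  exact: (integrable_compensated sN hI hs0 T0' (W0 k) (WC k) (mW k) (EW k)).
have prod_int : P.-integrable [set: Omega]
    (fun w => (M (psi i) w * M (psi j) w)%:E).
  exact: (integrable_compensatedM sN hI hs0 T0' (W0 i) (W0 j) (WC i) (WC j)
    (mW i) (mW j) (EW i) (EW j)).
rewrite /fisher_info mxE (covariance_centered (mean0 i) (mean0 j)).
rewrite -(compensated_covariance sN hI hs0 T0' (W0 i) (W0 j) (WC i) (WC j)
  (mW i) (mW j) (EW i) (EW j)).
apply: etrans _ (integralZl measurableT prod_int _).
apply: eq_integral_ae.
apply: filterS2 (score_compensated i) (score_compensated j) => w -> ->.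
by rewrite -EFinM; congr (_%:E); ring.
Qed.

Lemma fisher_info_intensity_weights i j :
  fisher_info_intensity P N g s0 T v0 i j =
  (score_sign i * score_sign j)%:E * EE (psi i \* psi j).
Proof.
rewrite /fisher_info_intensity mxE.
have prod0 x : 0 <= (psi i \* psi j) x * lam x.
  by rewrite mule_ge0// mule_ge0// score_weight_ge0.
have point w t : ((partial (fun u => fine (param_intensity g s0 u (N w) t)) v0 i *
    partial (fun u => fine (param_intensity g s0 u (N w) t)) v0 j /
    fine (param_intensity g s0 v0 (N w) t))%R)%:E =
    (score_sign i * score_sign j)%:E * ((psi i \* psi j) (t, w) * lam (t, w)).
  rewrite !partial_hawkes_intensity param_intensity_true /= /score_weight.
  have [[e e0 [-> ->]]|[-> ->]] := lambda_cases (t, w) => /=.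
    have pos : (0 < mu + rho * e)%R by rewrite ltr_pwDl// mulr_ge0// ltW.
    rewrite -!EFinM; congr (_%:E).
    by case: (i == ord0); case: (j == ord0); field; rewrite gt_eqF.
  by rewrite invr0 !mulr0; case: (i == ord0); case: (j == ord0); rewrite !(mule0, mul0e).
under eq_integral => w _.
  rewrite integral_itv_cc_oc; under eq_integral do rewrite point; over.
have [->|->] : (score_sign i * score_sign j)%R = 1%R \/
    (score_sign i * score_sign j)%R = (- 1)%R.
  rewrite /score_sign; case: (i == ord0); case: (j == ord0);
    rewrite ?mulr1 ?mul1r ?mulrNN ?mulr1; by [left|right].
  rewrite mul1e; apply: eq_integral => w _; apply: eq_integral => t _.
  by rewrite mul1e.
rewrite EFinN mulN1e -integral_ge0N; last first.
  by move=> w _; apply: integral_ge0.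
apply: eq_integral => w _; rewrite -integral_ge0N//.
by apply: eq_integral => t _; rewrite mulN1e.
Qed.

Let mW := measurable_score_weight.

(** * The moments of the weights and the information matrix *)

Lemma predictable_finite_lambda : predictable finite_lambda.
Proof.
rewrite (_ : finite_lambda = fun x => ((1 - rho)^-1)%:E *
    (rho%:E * psi 1%R x + (1 - rho)%:E * psi 0%R x)).
  by apply: measurable_funeM; apply: emeasurable_funD; apply: measurable_funeM; exact: mW.
apply/funext => x; rewrite /finite_lambda /= -!EFinM; congr (_%:E).
by rewrite score_weight_relation mulKf// gt_eqF.
Qed.

Lemma mean_score_weight_relation (h : R * Omega -> R) :
  (forall x, (0 <= h x)%R) -> predictable (EFin \o h) ->
  rho%:E * EE (psi 1%R \* (EFin \o h)) + (1 - rho)%:E * EE (psi 0%R \* (EFin \o h)) =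
  (1 - rho)%:E * EE (finite_lambda \* (EFin \o h)).
Proof.
move=> h0 mh.
have W0 := score_weight_ge0.
have ph0 i x : 0 <= (psi i \* (EFin \o h)) x by rewrite mule_ge0// ?W0// lee_fin.
have mph i : predictable (psi i \* (EFin \o h)) by apply: emeasurable_funM.
have uh0 x : 0 <= (finite_lambda \* (EFin \o h)) x by rewrite mule_ge0// lee_fin.
have muh : predictable (finite_lambda \* (EFin \o h)).
  by apply: emeasurable_funM => //; exact: predictable_finite_lambda.
have r0 := ltW rho0; have a0 := ltW rho1'.
have e1 := mean_intensityZ sN hI hs0 T0' r0 (ph0 1%R) (mph 1%R).
have e0 := mean_intensityZ sN hI hs0 T0' a0 (ph0 0%R) (mph 0%R).
have eu := mean_intensityZ sN hI hs0 T0' a0 uh0 muh.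
have f10 x : 0 <= rho%:E * (psi 1%R \* (EFin \o h)) x.
  by apply: mule_ge0; [rewrite lee_fin|exact: ph0].
have f00 x : 0 <= (1 - rho)%:E * (psi 0%R \* (EFin \o h)) x.
  by apply: mule_ge0; [rewrite lee_fin|exact: ph0].
have mf1 : predictable (fun x => rho%:E * (psi 1%R \* (EFin \o h)) x).
  exact: measurable_funeM.
have mf0 : predictable (fun x => (1 - rho)%:E * (psi 0%R \* (EFin \o h)) x).
  exact: measurable_funeM.
apply: etrans (congr2 adde (esym e1) (esym e0)) _.
apply: etrans (esym (mean_intensityD sN hI hs0 T0' f10 f00 mf1 mf0)) _.
apply: etrans _ eu.
congr (mean_intensity _ _ _ _ _); apply/funext => x.
suff e : (rho * (score_weight 1 x * h x) + (1 - rho) * (score_weight 0 x * h x) =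
    (1 - rho) * ((lam x \is a fin_num)%:R * h x))%R.
  by rewrite /finite_lambda /= -!EFinM; congr (_%:E); exact: e.
by rewrite [RHS]mulrA -score_weight_relation [RHS]mulrDl !mulrA.
Qed.

Let fin_EE (f : R * Omega -> \bar R) : (forall x, 0 <= f x) -> EE f < +oo ->
  EE f \is a fin_num.
Proof. by move=> f0 fy; rewrite ge0_fin_numE// (mean_intensity_ge0 hI). Qed.

Let q i := fine (EE (psi i)).
Let Q i j := fine (EE (psi i \* psi j)).
Let F := fine (EE (cst 1)).

Lemma mean_weightE i : EE (psi i) = (q i)%:E.
Proof.
by rewrite fineK//; apply: fin_EE; [exact: score_weight_ge0|exact: mean_score_weight_fin].
Qed.

Lemma mean_weight2E i j : EE (psi i \* psi j) = (Q i j)%:E.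
Proof.
rewrite fineK//; apply: fin_EE => [x|].
  by rewrite mule_ge0// score_weight_ge0.
have ir0 : (0 <= rho^-1)%R by rewrite invr_ge0 ltW.
apply: (@le_lt_trans _ _ (EE (fun x => (rho^-1)%:E * psi j x))).
  apply: (le_mean_intensity hI) => x; first by rewrite mule_ge0// score_weight_ge0.
  by apply: lee_wpmul2r; [exact: score_weight_ge0|exact: score_weight_le].
rewrite (mean_intensityZ sN hI hs0 T0' ir0 (score_weight_ge0 j) (mW j)).
by rewrite lte_mul_pinfty ?lee_fin// mean_score_weight_fin.
Qed.

Lemma mean_pointsE : EE (cst 1) = F%:E.
Proof. by rewrite fineK//; apply: fin_EE => //; exact: mean_points_fin. Qed.

Lemma mean_points_ge0 : (0 <= F)%R.
Proof. by rewrite -lee_fin -mean_pointsE (mean_intensity_ge0 hI). Qed.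

Lemma mean_weight0 : q 0%R = (mu * T)%R.
Proof. by rewrite /q mean_baseline_weight. Qed.

Let fin_relation (x y z : \bar R) (a b c : R) :
  x = a%:E -> y = b%:E -> z = c%:E ->
  rho%:E * x + (1 - rho)%:E * y = (1 - rho)%:E * z ->
  (rho * a + (1 - rho) * b = (1 - rho) * c)%R.
Proof. by move=> -> -> ->; rewrite -!EFinM -EFinD => -[]. Qed.

Lemma mean_weight_sum : (rho * q 1%R + (1 - rho) * q 0%R = (1 - rho) * F)%R.
Proof.
have h := mean_score_weight_relation (fun=> ler01) (measurable_cst _).
have one f : EE (f \* (EFin \o fun=> 1%R)) = EE f.
  by congr (mean_intensity _ _ _ _ _); apply/funext => x; rewrite /= mule1.
exact: fin_relation (etrans (one _) (mean_weightE 1%R))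
  (etrans (one _) (mean_weightE 0%R))
  (etrans (one _) (etrans mean_finite_lambda mean_pointsE)) h.
Qed.

(** The relation between the weights, multiplied by psi_i lambda. *)
Lemma mean_weight2_sum i :
  (rho * Q 1%R i + (1 - rho) * Q 0%R i = (1 - rho) * q i)%R.
Proof.
have W0 x : (0 <= score_weight i x)%R by have := score_weight_ge0 i x; rewrite lee_fin.
have h := mean_score_weight_relation W0 (mW i).
have e : EE (finite_lambda \* psi i) = EE (psi i).
  congr (mean_intensity _ _ _ _ _); apply/funext => x.
  by rewrite /finite_lambda /= -EFinM mulrC score_weight_finite.
exact: fin_relation (mean_weight2E 1%R i) (mean_weight2E 0%R i)
  (etrans e (mean_weightE i)) h.
Qed.

Lemma mean_weight2C i j : Q i j = Q j i.
Proof.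
rewrite /Q; congr (fine (mean_intensity _ _ _ _ _)).
by apply/funext => x /=; rewrite muleC.
Qed.

(** Integrating (k - psi_0)^2 lambda >= 0 gives 2 k mu T <= k^2 F + Q_00 for
    every k > 0, and Q_00 > 0 for k small. *)
Lemma baseline_weight2_gt0 : (0 < Q 0%R 0%R)%R.
Proof.
have key (k : R) : (0 < k)%R -> (2 * k * (mu * T) <= k ^+ 2 * F + Q 0%R 0%R)%R.
  move=> kgt0; have W0 := score_weight_ge0.
  have kk0 : (0 <= 2 * k)%R by rewrite mulr_ge0// ltW.
  have k20 : (0 <= k ^+ 2)%R by exact: sqr_ge0.
  have c10 (x : R * Omega) : 0 <= (cst 1 x : \bar R) by [].
  have mc1 : predictable (cst 1) by exact: measurable_cst.
  have PP0 x : 0 <= (psi 0%R \* psi 0%R) x by rewrite mule_ge0// W0.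
  have mPP : predictable (psi 0%R \* psi 0%R) by apply: emeasurable_funM.
  have kc0 (x : R * Omega) : 0 <= (k ^+ 2)%:E * cst 1 x :> \bar R.
    by apply: mule_ge0; [rewrite lee_fin|exact: c10].
  have mkc : predictable (fun x => (k ^+ 2)%:E * cst 1 x).
    exact: measurable_funeM.
  have E2 : EE (fun x => (2 * k)%:E * psi 0%R x) = (2 * k * (mu * T))%:E.
    apply: etrans (mean_intensityZ sN hI hs0 T0' kk0 (W0 0%R) (mW 0%R)) _.
    by apply: etrans (congr1 (mule _) mean_baseline_weight) _; rewrite -EFinM.
  have ES : EE ((fun x => (k ^+ 2)%:E * cst 1 x) \+ (psi 0%R \* psi 0%R)) =
      (k ^+ 2 * F + Q 0%R 0%R)%:E.
    apply: etrans (mean_intensityD sN hI hs0 T0' kc0 PP0 mkc mPP) _.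
    have EZ := mean_intensityZ sN hI hs0 T0' k20 c10 mc1.
    by apply: etrans (congr2 adde (etrans EZ (congr1 (mule _) mean_pointsE))
      (mean_weight2E 0%R 0%R)) _; rewrite -!EFinM -?EFinD.
  have le_pt x : (2 * k)%:E * psi 0%R x <=
      ((fun x => (k ^+ 2)%:E * cst 1 x) \+ (psi 0%R \* psi 0%R)) x.
    rewrite /= mule1 -!EFinM -?EFinD lee_fin.
    by have := sqr_ge0 (k - score_weight 0 x)%R; rewrite /score_weight/=; nra.
  have ge0_pt x : 0 <= (2 * k)%:E * psi 0%R x by rewrite mule_ge0 ?W0 ?lee_fin.
  have := le_mean_intensity hI 0%R T ge0_pt le_pt.
  by rewrite E2 ES lee_fin.
have F0 := mean_points_ge0.
have muT : (0 < mu * T)%R by rewrite mulr_gt0.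
have F1 : (0 < F + 1)%R by rewrite ltr_wpDl.
(* F + 1 keeps the quotient defined and leaves k^2 F < k mu T *)
have := key _ (divr_gt0 muT F1); set k := (_ / _)%R => kle.
have kpos : (0 < k)%R by exact: divr_gt0.
have kF : (k * (F + 1) = mu * T)%R by rewrite /k divfK// gt_eqF.
by nra.
Qed.

Lemma baseline_integral : \int[P]_w \int[leb]_(t in `[0%R, T])
  (mu / fine (lam (t, w)))%:E = (mu^-1 * Q 0%R 0%R)%:E.
Proof.
have PP0 x : 0 <= (psi 0%R \* psi 0%R) x by rewrite mule_ge0// score_weight_ge0.
have mPP : predictable (psi 0%R \* psi 0%R) by apply: emeasurable_funM.
have mi0 : (0 <= mu^-1)%R by rewrite invr_ge0 ltW.
rewrite EFinM -mean_weight2E -(mean_intensityZ sN hI hs0 T0' mi0 PP0 mPP).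
apply: eq_integral => w _; rewrite integral_itv_cc_oc; apply: eq_integral => t _.
by rewrite -muleA sqr_baseline_weight /= -!EFinM mulKf// gt_eqF.
Qed.

Lemma intensity_integral (c : R) : (0 <= c)%R ->
  \int[P]_w \int[leb]_(t in `[0%R, T]) (lam (t, w) * c%:E) = (c * F)%:E.
Proof.
move=> c0; rewrite EFinM -mean_pointsE.
rewrite -(mean_intensityZ sN hI hs0 T0' c0 (fun=> lee01) (measurable_cst _)).
apply: eq_integral => w _; rewrite integral_itv_cc_oc; apply: eq_integral => t _.
by rewrite mule1 muleC.
Qed.

Lemma stationary_points : s0 = -oo -> F = (T * mu / (1 - rho))%R.
Proof. by move=> /mean_points_stationary; rewrite mean_pointsE => -[]. Qed.

Lemma fisher_infoE i j : fisher_info P N g s0 T v0 i j =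
  (score_sign i * score_sign j * Q i j)%:E.
Proof. by rewrite fisher_info_weights mean_weight2E -EFinM. Qed.

Lemma fisher_info_intensityE i j : fisher_info_intensity P N g s0 T v0 i j =
  (score_sign i * score_sign j * Q i j)%:E.
Proof. by rewrite fisher_info_intensity_weights mean_weight2E -EFinM. Qed.

(** B and D stand for Q_00 and F; the relations [mean_weight_sum] and
    [mean_weight2_sum] are solved for q_1, Q_10 and Q_11. *)
Lemma fisher_info_closed_form :
  let a := (1 - rho)%R in
  let D := (T^-1 * fine (\int[P]_w \int[leb]_(t in `[0%R, T])
     (lam (t, w) * ((mu / a)^-1)%:E)))%R in
  let B := (T^-1 * fine (\int[P]_w \int[leb]_(t in `[0%R, T])
     (mu / fine (lam (t, w)))%:E))%R in
  let J := (T * mu * a *: sym_mx2 (B / a) (- ((1 - B) / rho))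
     ((D - 2 * a + a * B) / rho ^+ 2))%R in
  [/\ fisher_info P N g s0 T v0 = map_mx EFin J,
      fisher_info_intensity P N g s0 T v0 = map_mx EFin J,
      (0 < B)%R & s0 = -oo -> D = 1%R].
Proof.
move=> a D B J.
have a0 : (0 < a)%R by [].
have DE : (D = T^-1 * ((mu / a)^-1 * F))%R.
  have c0 : (0 <= (mu / a)^-1)%R by rewrite invr_ge0 divr_ge0// ltW.
  rewrite /D; congr (T^-1 * _)%R.
  have h := intensity_integral c0.
  apply: etrans (congr1 fine h) _.
  by [].
have BE : (B = T^-1 * (mu^-1 * Q 0%R 0%R))%R.
  rewrite /B; congr (T^-1 * _)%R.
  exact: etrans (congr1 fine baseline_integral) _.
clearbody D B.
have T0n : T != 0%R by rewrite gt_eqF.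
have mun : mu != 0%R by rewrite gt_eqF.
have rhon : rho != 0%R by rewrite gt_eqF.
have an : a != 0%R by rewrite gt_eqF.
have QJ i j : (score_sign i * score_sign j * Q i j)%R = J i j.
  have Q00 : (Q 0 0 = T * mu * B)%R by rewrite BE; field; rewrite T0n mun.
  have Q10 : (Q 1 0 = T * mu * a * ((1 - B) / rho))%R.
    have := mean_weight2_sum 0%R; rewrite mean_weight0 Q00 -/a => h.
    apply: (mulfI rhon); rewrite [RHS](_ : _ = a * (mu * T) - a * (T * mu * B))%R.
      by rewrite -h; ring.
    by field.
  have F_D : (F = T * mu / a * D)%R by rewrite DE; field; rewrite T0n mun an.
  have q1 : (q 1 = (a * F - a * (mu * T)) / rho)%R.
    have := mean_weight_sum; rewrite mean_weight0 -/a => h.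
    by rewrite -h; field.
  have Q11 : (Q 1 1 = T * mu * a * ((D - 2 * a + a * B) / rho ^+ 2))%R.
    have := mean_weight2_sum 1%R; rewrite [Q 0%R 1%R]mean_weight2C Q10 q1 F_D -/a => h.
    apply: (mulfI rhon); apply: (addIr (a * (T * mu * a * ((1 - B) / rho)))%R).
    by rewrite h; field; rewrite rhon an.
  have i01 (k : 'I_2) : k = 0%R \/ k = 1%R.
    by case: k => -[|[|//]] p; [left|right]; exact: val_inj.
  rewrite /J !mxE /score_sign; case: (i01 i) => ->; case: (i01 j) => -> /=.
  - by rewrite Q00 !mul1r; field.
  - by rewrite [Q 0%R 1%R]mean_weight2C Q10; ring.
  - by rewrite Q10; ring.
  - by rewrite Q11; ring.
split.
- by apply/matrixP => i j; rewrite fisher_infoE QJ [RHS]mxE.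
- by apply/matrixP => i j; rewrite fisher_info_intensityE QJ [RHS]mxE.
- by rewrite BE !mulr_gt0 ?invr_gt0// baseline_weight2_gt0.
- by move=> s0y; rewrite DE (stationary_points s0y) -/a; field; rewrite T0n mun an.
Qed.

End hawkes_fisher.

Theorem corollary4p2 (R : realType) (d : measure_display)
    (Omega : measurableType d) (P : probability Omega R)
    (N : Omega -> set R) (g : R -> R) (s0 : \bar R) (mu rho T : R)
    (hs0 : (s0 <= 0)%E) (hT : 0 < T)
    (hmu : 0 < mu) (hrho0 : 0 < rho) (hrho1 : rho < 1)
    (mg : measurable_fun (`[0, +oo[ : set R) g)
    (hg0 : forall x, 0 <= x -> 0 <= g x)
    (hg1 : ((\int[@lebesgue_measure R]_(x in `[0%R, +oo[) (g x)%:E) = 1)%E)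
    (hN : hawkes_process P g s0 mu rho N) :
  let a := 1 - rho in
  let lambar := mu / (1 - rho) in
  let lam t w := hawkes_intensity g s0 mu rho (N w) t in
  let V t w := (lam t w * (lambar^-1)%:E)%E in
  let I := T * mu * (1 - rho) in
  let D := T^-1 * fine (\int[P]_w
    \int[@lebesgue_measure R]_(t in `[0%R, T]) V t w)%E in
  let B := T^-1 * fine (\int[P]_w
    \int[@lebesgue_measure R]_(t in `[0%R, T]) (mu / fine (lam t w))%:E)%E in
  let J := I *: sym_mx2 (B / a) (- ((1 - B) / rho))
                        ((D - 2 * a + a * B) / rho ^+ 2) in
  let FI := fisher_info P N g s0 T (hawkes_param mu rho) in
  [/\ FI = map_mx EFin J,
      fisher_info_intensity P N g s0 T (hawkes_param mu rho) = map_mx EFin J,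
      fine (FI 1 1) != 0 ->
        eff_info_log_mu (map_mx fine FI) =
        I / a * ((B * D - a) / (D - 2 * a + a * B)),
      eff_info_log_1rho (map_mx fine FI) =
        I / rho ^+ 2 * (D - a / B) &
      s0 = -oo%E -> D = 1].
Proof.
move=> a lambar lam V I D B J FI.
have [FIE FIIE B0 D1] :
    [/\ FI = map_mx EFin J,
        fisher_info_intensity P N g s0 T (hawkes_param mu rho) = map_mx EFin J,
        0 < B & s0 = -oo%E -> D = 1].
  exact: (fisher_info_closed_form hs0 hT hmu hrho0 hrho1 mg hg0 hg1 hN).
have JE : map_mx fine FI = J by apply/matrixP => i j; rewrite FIE !mxE.
have a0 : a != 0 by rewrite gt_eqF// subr_gt0.
have rho_neq0 : rho != 0 by rewrite gt_eqF.
have B_neq0 : B != 0 by rewrite gt_eqF.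
have I0 : I != 0 by rewrite !mulf_neq0// gt_eqF.
have J00 : J 0 0 = I * (B / a) by rewrite !mxE.
have J01 : J 0 1 = - (I * ((1 - B) / rho)) by rewrite !mxE /= mulrN.
have J11 : J 1 1 = I * ((D - 2 * a + a * B) / rho ^+ 2) by rewrite !mxE.
have rhoE : rho = 1 - a by rewrite /a subKr.
(* in both cases the only relation between the quantities is rho = 1 - a *)
split => //; rewrite ?JE /eff_info_log_mu /eff_info_log_1rho J00 J01 J11.
- rewrite FIE mxE /= J11 !mulf_eq0 !negb_or => /andP[_ /andP[K0 _]].
  move: (I) (D) (B) (a) rhoE I0 a0 rho_neq0 B_neq0 K0; clear => I D B a rhoE.
  rewrite rhoE => I0 a0 rho0 B0 K0.
  by field; rewrite K0 rho0 a0.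
- move: (I) (D) (B) (a) rhoE I0 a0 rho_neq0 B_neq0; clear => I D B a rhoE.
  rewrite rhoE => I0 a0 rho0 B0.
  by field; rewrite I0 rho0 a0 B0.
Qed.
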